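(* Let $(G,G^{+})$ be a simple dimension group with a specified order unit $e$ (states being taken with respect to $e$), with elements $u^{1},u^{2}\in G$ and exactly two extremal states $\sigma_{1},\sigma_{2}$, such that $\sigma_{1}(u^{1})=\sigma_{2}(u^{2})=1$ and $\sigma_{2}(u^{1})=\sigma_{1}(u^{2})=0$. Let $a_{n}$, $n=1,2,\ldots$, be a sequence of positive integers. Then there exist: 1. a sequence of positive integers $J_{n}$, $n\ge1$; 2. vectors $u^{1,1}_{n},u^{1,2}_{n},u^{2,1}_{n},u^{2,2}_{n}\in\mathbb{Z}^{J_{n}}$ for all $n\ge1$; 3. $J_{n+1}\times J_{n}$ matrices $A^{1,1}_{n},A^{1,2}_{n},A^{2,1}_{n},A^{2,2}_{n}$ with strictly positive integer entries, for all $n\ge1$, such that the inductive limit of the sequence $$\mathbb{Z}^{J_{1}}\oplus\mathbb{Z}^{J_{1}}\to\mathbb{Z}^{J_{2}}\oplus\mathbb{Z}^{J_{2}}\to\cdots$$ whose $n$-th connecting map is $\begin{bmatrix} A_{n}^{1,1} & A_{n}^{1,2} \\ A_{n}^{2,1} & A_{n}^{2,2} \end{bmatrix}$ is isomorphic to $(G,G^{+})$ as ordered abelian groups, and such that, if $\eta_{n}$ denotes the resulting natural map from $\mathbb{Z}^{J_{n}}\oplus\mathbb{Z}^{J_{n}}$ to $G$, then for $i=1,2$ and all $n\ge 1$, $\eta_{n}(u_{n}^{i,1},u_{n}^{i,2})=u^{i}$ and $$\begin{bmatrix} A_{n}^{1,1} & A_{n}^{1,2} \\ A_{n}^{2,1}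 & A_{n}^{2,2} \end{bmatrix} \begin{bmatrix} u_{n}^{i,1} \\ u_{n}^{i,2} \end{bmatrix} = \begin{bmatrix} u_{n+1}^{i,1} \\ u_{n+1}^{i,2} \end{bmatrix}.$$ In addition, there exist a decreasing sequence of rational numbers $r_{n}$, $n\ge1$, with $2>r_{n}>1$ and limit $1$, and increasing sequences of positive integers $K_{n},l_{n},M_{n}$, $n\ge1$, all at least $4$, such that for all $n\ge1$: 4. $$r_{n}^{-1}K_{n}\le u_{n}^{1,1},\,u_{n}^{2,2}\le r_{n}K_{n},\qquad -r_{n}K_{n}\le l_{n}u_{n}^{1,2},\,l_{n}u_{n}^{2,1}\le -r_{n}^{-1}K_{n};$$ 5. for all $1\le j',j''\le J_{n+1}$ and $1\le j\le J_{n}$, $$a_{n}\le A_{n}^{1,2}(j',j),\qquad a_{n}\le A_{n}^{2,1}(j',j),$$ $$r_{n}^{-1}A_{n}^{1,1}(j',j)\le l_{n}A_{n}^{2,1}(j'',j)\le r_{n}A_{n}^{1,1}(j',j),$$ $$r_{n}^{-1}A_{n}^{2,2}(j',j)\le l_{n}A_{n}^{1,2}(j'',j)\le r_{n}A_{n}^{2,2}(j',j);$$ 6. for all $1\le j'\le J_{n+1}$, $$r_{n}^{-1}M_{n}\le\sum_{j=1}^{J_{n}}A_{n}^{1,1}(j',j),\ \sum_{j=1}^{J_{n}}A_{n}^{2,2}(j',j)\le r_{n}M_{n}.$$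
   Context: For a vector $v\in\mathbb{R}^{I}$ and a real number $r$, $v\le r$ means $v(i)\le r$ for all $i$, and $v\ge r$ means $v(i)\ge r$ for all $i$; ''$a\le b,c\le d$'' means $a\le b\le d$ and $a\le c\le d$. $A(j',j)$ denotes the $(j',j)$ entry of a matrix $A$; elements of $\mathbb{Z}^{J}$ are column vectors. An ordered abelian group is a pair $(G,G^{+})$ with $G$ a (countable) abelian group and $G^{+}\subseteq G$ satisfying $G^{+}+G^{+}\subseteq G^{+}$, $G^{+}-G^{+}=G$, $G^{+}\cap(-G^{+})=\{0\}$. $\mathbb{Z}^{I}$ carries the simplicial order $\mathbb{Z}^{I+}=\{n:n(i)\ge0\text{ for all }i\}$. A dimension group is an ordered abelian group isomorphic to an inductive limit, in the category of ordered abelian groups, of a sequence of simplicially ordered groups $\mathbb{Z}^{I_{n}}$ with connecting maps given by non-negative integer matrices (the positive cone of the limit is the union of the images of the cones $\mathbb{Z}^{I_{n}+}$ under the canonical maps); equivalently (Effros–Handelman–Shen), it is countable, unperforated and satisfies Riesz interpolation. An element $u\in G^{+}$ is an order unit if for every $a\in G$ there is a positive integer $k$ with $ku-a\in G^{+}$. A dimension group is simple if it has no order ideals other than $\{0\}$ and $G$; equivalently, every non-zero positive element is an order unit. A state with respect to an order unit $e$ is a group homomorphism $\tau:G\to\mathbb{R}$ with $\tau(G^{+})\subseteq[0,\infty)$ and $\tau(e)=1$. The states form a compact convex subset of $\mathbb{R}^{G}$; a state is extremal if it is an extreme point of this set. *)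

(* Defs.v *)
From HB Require Import structures.
From mathcomp Require Import all_boot all_order all_algebra.
From mathcomp Require Import all_classical all_reals all_analysis.

Set Implicit Arguments.
Unset Strict Implicit.
Unset Printing Implicit Defensive.

Import Order.TTheory GRing.Theory Num.Theory.
Import numFieldNormedType.Exports.

Local Open Scope classical_set_scope.
Local Open Scope ring_scope.

(* [P] is the positive cone G^+ of [G]. *)
Definition ordered_group (G : zmodType) (P : set G) : Prop :=
  [/\ countable [set: G],
      forall x y, P x -> P y -> P (x + y),
      forall x, exists y z, [/\ P y, P z & x = y - z]
    & [set x | P x /\ P (- x)] = [set 0]].

Definition positive_hom (G H : zmodType) (P : set G) (Q : set H) (f : G -> H) :
  Prop := forall x, P x -> Q (f x).

(* The simplicial order on Z^d, elements of Z^d being column vectors. *)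
Definition simplicial_cone (d : nat) : set 'cV[int]_d :=
  [set v | forall i, 0 <= v i 0].

(* A sequence of matrices [A n] stands for the sequence
   Z^(d 0) -> Z^(d 1) -> ... of simplicially ordered groups.  It is a sequence
   of ordered abelian groups when the entries of the [A n] are nonnegative. *)
Definition cocone (d : nat -> nat) (A : forall n, 'M[int]_(d n.+1, d n))
    (G : zmodType) (P : set G) (eta : forall n, {additive 'cV[int]_(d n) -> G}) :
  Prop :=
  (forall n, positive_hom (@simplicial_cone (d n)) P (eta n)) /\
  (forall n x, eta n.+1 (A n *m x) = eta n x).

(* (G, P), with the canonical maps [eta], is an inductive limit (colimit) of
   the sequence in the category of ordered abelian groups and positive
   homomorphisms.  Being stated by the universal property, this is invariant
   under isomorphism; the maps [eta n] are then the canonical maps of any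
   construction of the limit, followed by an isomorphism onto (G, P). *)
Definition inductive_limit (d : nat -> nat) (A : forall n, 'M[int]_(d n.+1, d n))
    (G : zmodType) (P : set G) (eta : forall n, {additive 'cV[int]_(d n) -> G}) :
  Prop :=
  [/\ ordered_group P,
      cocone A P eta
    & forall (H : zmodType) (Q : set H)
        (theta : forall n, {additive 'cV[int]_(d n) -> H}),
        ordered_group Q -> cocone A Q theta ->
        exists f : {additive G -> H},
          [/\ positive_hom P Q f,
              forall n x, f (eta n x) = theta n x
            & forall g : {additive G -> H}, positive_hom P Q g ->
                (forall n x, g (eta n x) = theta n x) -> g =1 f]].

Definition dimension_group (G : zmodType) (P : set G) : Prop :=
  ordered_group P /\
  exists (d : nat -> nat) (A : forall n, 'M[int]_(d n.+1, d n))
    (eta : forall n, {additive 'cV[int]_(d n) -> G}),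
    (forall n i j, 0 <= A n i j) /\ inductive_limit A P eta.

(* A directed, convex subgroup. *)
Definition order_ideal (G : zmodType) (P I : set G) : Prop :=
  [/\ I 0,
      forall x y, I x -> I y -> I (x - y),
      forall x, I x -> exists y z, [/\ I y /\ P y, I z /\ P z & x = y - z]
    & forall x y, P x -> P (y - x) -> I y -> I x].

Definition simple_group (G : zmodType) (P : set G) : Prop :=
  forall I : set G, order_ideal P I -> I = [set 0] \/ I = [set: G].

Definition order_unit (G : zmodType) (P : set G) (u : G) : Prop :=
  P u /\ forall a, exists k : nat, (0 < k)%N /\ P (u *+ k - a).

Definition states (R : realType) (G : zmodType) (P : set G) (e : G) :
  set (G -> R) :=
  [set tau | [/\ {morph tau : x y / x + y},
                 forall x, P x -> 0 <= tau x
               & tau e = 1]].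

Definition extreme_points (R : realType) (V : lmodType R) (S : set V) : set V :=
  [set v | S v /\ forall (x y : V) (t : R), S x -> S y -> 0 < t < 1 ->
             v = t *: x + (1 - t) *: y -> x = v /\ y = v].

Definition extremal_states (R : realType) (G : zmodType) (P : set G) (e : G) :
  set (G -> R) :=
  extreme_points (@states R G P e).

(* lo <= x <= hi for an integer x and rational bounds. *)
Definition in_range (lo hi : rat) (x : int) : bool := lo <= x%:~R <= hi.

(* Main.v *)
Require Import Defs.
From HB Require Import structures.
From mathcomp Require Import all_boot all_order all_algebra.
From mathcomp Require Import all_classical all_reals all_analysis.
From mathcomp Require Import zify lra.

Set Implicit Arguments.
Unset Strict Implicit.
Unset Printing Implicit Defensive.

Import Order.TTheory GRing.Theory Num.Theory.
Import numFieldNormedType.Exports.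

Local Open Scope classical_set_scope.
Local Open Scope ring_scope.

(* Put sigma = (sigma_1, sigma_2) : G -> R^2.  Because G is simple and
   unperforated and has no other extremal state, g is positive as soon as
   sigma_1 g > 0 and sigma_2 g > 0 (otherwise a lexicographically maximal state
   starting with - g would be an extremal state that is not positive at g).
   Because sigma_1 and sigma_2 are distinct extremal states, their infimum is 0,
   so below every positive f there are elements whose image under sigma is as
   lopsided as one wishes, and sigma(G) is dense in R^2.

   Given a finite family in G, factor it through a family h_1, ..., h_p so
   that its relations die.  Choose s_1, s_2 in G with sigma(s_1), sigma(s_2) very
   close to s (1, 1/l) and s (1/l, 1), for l large and s then tiny.  Writing
   h_k = C_k s_1 + D_k s_2 + rho_k with C_k, D_k the integer parts of the
   coordinates of sigma(h_k), the elements s_1, T s_1 + rho_k, T s_1 - sum_k rho_k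
   and s_2, T s_2, ..., T s_2, for a fixed large T, are positive, have directions
   close to those of s_1 and s_2, and sum to N s_1 and N s_2.  In terms of them
   every h_k has almost constant coefficients, about C_k / N on the first group
   and D_k / N on the second one.  Since C_k and D_k are proportional, up to a
   small error, to sigma_1(h_k) - sigma_2(h_k) / l and
   sigma_2(h_k) - sigma_1(h_k) / l, all the required estimates hold when this
   step is iterated on the generators of the previous level, an enumeration of
   the positive elements, u^1 and u^2. *)

(** * Inductive limits of simplicial groups *)

Section System.
Variables (d : nat -> nat) (A : forall n, 'M[int]_(d n.+1, d n)).

Fixpoint transport n k : 'cV[int]_(d n) -> 'cV[int]_(d (k + n)) :=
  if k is k'.+1 then fun x => A (k' + n) *m transport k' x else id.

Lemma transport_is_zmod_morphism n k : zmod_morphism (@transport n k).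
Proof. by elim: k => //= k IH x y; rewrite IH mulmxBr. Qed.
HB.instance Definition _ n k := GRing.isZmodMorphism.Build
  'cV[int]_(d n) 'cV[int]_(d (k + n)) (@transport n k)
  (@transport_is_zmod_morphism n k).

Lemma transport_cocone (G : zmodType) (eta : forall n, {additive 'cV[int]_(d n) -> G}) :
  (forall n x, eta n.+1 (A n *m x) = eta n x) ->
  forall n k x, eta (k + n)%N (transport k x) = eta n x.
Proof. by move=> etaA n; elim=> //= k IH x; rewrite etaA. Qed.

Lemma transport_ge0 n k x : (forall n i j, 0 <= A n i j) ->
  simplicial_cone x -> simplicial_cone (@transport n k x).
Proof.
move=> A0 x0; elim: k => //= k IH i; rewrite mxE.
by apply: sumr_ge0 => j _; apply: mulr_ge0 => //; apply: IH.
Qed.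

Lemma lift_level n N (x : 'cV[int]_(d n)) : (n <= N)%N ->
  exists y : 'cV[int]_(d N),
    (forall (G : zmodType) (eta : forall n, {additive 'cV[int]_(d n) -> G}),
       (forall n x, eta n.+1 (A n *m x) = eta n x) -> eta N y = eta n x) /\
    ((forall n i j, 0 <= A n i j) -> simplicial_cone x -> simplicial_cone y).
Proof.
move=> /subnK <-; exists (transport (N - n) x); split.
  by move=> G eta etaA; apply: transport_cocone.
exact: transport_ge0.
Qed.

(** A mediating map is forced by its values on representatives. It is well defined because a vector
    killed by [eta] is killed by some transport, hence by every compatible [theta]. *)
Lemma limit_criterion (G : zmodType) (P : set G)
    (eta : forall n, {additive 'cV[int]_(d n) -> G}) :
  ordered_group P -> cocone A P eta ->
  (forall x, P x -> exists n v, simplicial_cone v /\ eta n v = x) ->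
  (forall n v, eta n v = 0 -> exists k, transport k v = 0) ->
  inductive_limit A P eta.
Proof.
move=> oP [etaP etaA] surP ker; split=> // H Q theta oQ [thQ thA].
(* The cone generates G: lift both terms of a difference of positive elements to a common level. *)
have sur x : exists nv : {n & 'cV[int]_(d n)}, eta (tag nv) (tagged nv) = x.
  have [_ _ /(_ x)[y [z [/surP[n [v [_ <-]]] /surP[m [w [_ <-]]] ->]]] _] := oP.
  have [x' [/(_ _ _ etaA) <- _]] := lift_level v (leq_addr m n).
  have [y' [/(_ _ _ etaA) <- _]] := lift_level w (leq_addl n m).
  by exists (Tagged (fun n => 'cV[int]_(d n)) (x' - y')); rewrite /= raddfB.
have [s sE] := choice sur.
pose f x := theta _ (tagged (s x)).
have fE n x : f (eta n x) = theta n x.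
  rewrite /f; move: (s _) (sE (eta n x)) => [m y] /=.
  have [x' [ex _]] := lift_level x (leq_addr m n).
  have [y' [ey _]] := lift_level y (leq_addl n m).
  rewrite -(ex _ _ etaA) -(ey _ _ etaA) -(ex _ _ thA) -(ey _ _ thA) => e.
  have /ker[k /(congr1 (theta _))] : eta _ (x' - y') = 0 by rewrite raddfB/= e subrr.
  rewrite transport_cocone// raddf0 raddfB => /eqP.
  by rewrite subr_eq0 => /eqP.
have f_add : zmod_morphism f.
  move=> x y; have [[n v] /= <-] := sur x; have [[m w] /= <-] := sur y.
  have [x' [/(_ _ _ etaA) <- _]] := lift_level v (leq_addr m n).
  have [y' [/(_ _ _ etaA) <- _]] := lift_level w (leq_addl n m).
  by rewrite -raddfB !fE raddfB.
pose fM := GRing.isZmodMorphism.Build G H f f_add.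
pose F : {additive G -> H} := HB.pack f fM.
exists F; split => //.
- by move=> x /surP[n [v [v0 <-]]]; rewrite /F /= fE; apply: thQ.
move=> g _ gE x; have [[n v] /= <-] := sur x.
by rewrite gE /F /= fE.
Qed.

End System.

(** * A concrete model of the inductive limit *)

Section ConcreteLimit.
Variables (d : nat -> nat) (A : forall n, 'M[int]_(d n.+1, d n)).

(* A bivariate polynomial [F] stands for the finite family of vectors
   [F`_n : Z^(d n)]; [partial_value N F] is the image in Z^(d N) of its part of
   index at most [N]. *)
Definition vec_of_poly n (p : {poly int}) : 'cV[int]_(d n) := \col_i p`_i.

Fixpoint partial_value N (F : {poly {poly int}}) : 'cV[int]_(d N) :=
  if N is N'.+1 then A N' *m partial_value N' F + vec_of_poly N'.+1 F`_N'.+1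
  else vec_of_poly 0 F`_0.

Lemma partial_value_is_zmod_morphism N : zmod_morphism (partial_value N).
Proof.
elim: N => [|N IH] F F' /=; first by apply/matrixP=> i j; rewrite !mxE !coefB.
rewrite IH mulmxBr; apply/matrixP=> i j; rewrite !(mxE, coefB); lra.
Qed.
HB.instance Definition _ N := GRing.isZmodMorphism.Build _ _ (partial_value N)
  (@partial_value_is_zmod_morphism N).

Lemma partial_value_stable N k (F : {poly {poly int}}) : (size F <= N.+1)%N ->
  partial_value (k + N) F = transport A k (partial_value N F).
Proof.
move=> sF; elim: k => //= k ->; rewrite nth_default ?addr0; last first.
  by rewrite (leq_trans sF)// ltnS leq_addl.
by rewrite -[RHS]addr0; congr (_ + _); apply/matrixP=> i j; rewrite !mxE coef0.
Qed.

Lemma partial_value_stable0 N M (F : {poly {poly int}}) : (size F <= N.+1)%N -> (N <= M)%N ->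
  partial_value N F = 0 -> partial_value M F = 0.
Proof.
by move=> sF /subnK <- F0; rewrite partial_value_stable// F0 raddf0.
Qed.

(** The size bound ensures that level [N] has collected the whole family; coefficients beyond [d n]
    are dropped by [vec_of_poly] and so count as zero. *)
Definition null_family : {pred {poly {poly int}}} :=
  [pred F : {poly {poly int}} | `[< exists N, (size F <= N.+1)%N /\ partial_value N F = 0 >]].

Lemma null_familyP (F : {poly {poly int}}) : reflect
  (exists N, (size F <= N.+1)%N /\ partial_value N F = 0) (F \in null_family).
Proof. by rewrite unfold_in; exact: asboolP. Qed.

Lemma null_family_zmod_closed : zmod_closed null_family.
Proof.
split=> [|F F'].
  by apply/null_familyP; exists 0%N; rewrite size_poly0 raddf0.
move=> /null_familyP[N [sN N0]] /null_familyP[M [sM M0]]; apply/null_familyP.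
exists (N + M)%N; split.
  rewrite (leq_trans (size_polyD _ _))// size_polyN geq_max.
  by rewrite (leq_trans sN) ?(leq_trans sM)// ltnS ?leq_addr ?leq_addl.
rewrite raddfB/= (partial_value_stable0 sN _ N0) ?leq_addr//.
by rewrite (partial_value_stable0 sM _ M0) ?leq_addl// subrr.
Qed.
HB.instance Definition _ :=
  GRing.isZmodClosed.Build {poly {poly int}} null_family null_family_zmod_closed.

(** The direct sum of the levels, encoded by polynomials, modulo the families that die. The encoding
    makes countability immediate through representatives. *)
Definition limit_group : zmodType := Quotient.quot null_family.

Definition single_family n (v : 'cV[int]_(d n)) : {poly {poly int}} :=
  (\poly_(i < d n) (if insub i is Some j then v j 0 else 0))%:P * 'X^n.

Lemma coef_single_family n (v : 'cV[int]_(d n)) m :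
  (single_family v)`_m =
    if m == n then \poly_(i < d n) (if insub i is Some j then v j 0 else 0) else 0.
Proof. by rewrite coefCM coefXn; case: eqP; rewrite ?mulr1 ?mulr0. Qed.

Lemma single_family_is_zmod_morphism n : zmod_morphism (@single_family n).
Proof.
move=> x y; rewrite /single_family -mulrBl -polyCB; congr (_ %:P * _).
apply/polyP => i; rewrite coefB !coef_poly; case: ltnP => li; last by rewrite subr0.
by rewrite insubT !mxE.
Qed.

Lemma size_single_family n (v : 'cV[int]_(d n)) : (size (single_family v) <= n.+1)%N.
Proof. by apply/leq_sizeP => j; rewrite coef_single_family; case: eqP => // ->; rewrite ltnn. Qed.

Lemma partial_value_single n (v : 'cV[int]_(d n)) : partial_value n (single_family v) = v.
Proof.
have low m : (m < n)%N -> partial_value m (single_family v) = 0.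
  elim: m => [|m IH] /= mn.
    by apply/matrixP=> i j; rewrite !mxE coef_single_family ltn_eqF// coef0.
  rewrite IH ?(ltnW mn)// mulmx0 add0r.
  by apply/matrixP=> i j; rewrite !mxE coef_single_family ltn_eqF// coef0.
have top : vec_of_poly n (single_family v)`_n = v.
  apply/matrixP=> i j; rewrite !mxE coef_single_family eqxx coef_poly ltn_ord.
  by rewrite insubT// => lt; rewrite (ord1 j); congr (v _ _); apply: val_inj.
case: n => [|n] in v low top *; first exact: top.
by rewrite [LHS]/= low// mulmx0 add0r.
Qed.

Definition limit_map n (v : 'cV[int]_(d n)) : limit_group :=
  \pi_limit_group%qT (single_family v).

Lemma limit_map_is_zmod_morphism n : zmod_morphism (@limit_map n).
Proof.
move=> x y; rewrite /limit_map single_family_is_zmod_morphism.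
exact: (raddfB (\pi_(Quotient.quot null_family))%qT).
Qed.
HB.instance Definition _ n := GRing.isZmodMorphism.Build _ _ (@limit_map n)
  (@limit_map_is_zmod_morphism n).

Lemma limit_pi_eq0 (F : {poly {poly int}}) : ((\pi_limit_group F)%qT = 0) <-> F \in null_family.
Proof.
rewrite -(raddf0 (\pi_(Quotient.quot null_family))%qT) -[X in X \in _]subr0.
rewrite Quotient.idealrBE; split=> [/eqP//|/eqP//].
Qed.

Lemma limit_map_partial_value N (F : {poly {poly int}}) : (size F <= N.+1)%N ->
  limit_map (partial_value N F) = (\pi_limit_group F)%qT.
Proof.
move=> sF; apply/eqP; rewrite -subr_eq0; apply/eqP.
rewrite -(raddfB (\pi_(Quotient.quot null_family))%qT); apply/limit_pi_eq0.
apply/null_familyP; exists N; split; last first.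
  by rewrite raddfB/= partial_value_single subrr.
by rewrite (leq_trans (size_polyD _ _))// size_polyN geq_max sF size_single_family.
Qed.

Lemma limit_map_cocone n v : limit_map (A n *m v) = limit_map v.
Proof.
rewrite -[RHS](@limit_map_partial_value n.+1) ?(leq_trans (size_single_family _))//.
congr limit_map.
by rewrite (@partial_value_stable n 1) ?size_single_family//= partial_value_single.
Qed.

Lemma limit_map_eq0 n v : @limit_map n v = 0 -> exists k, transport A k v = 0.
Proof.
move=> /limit_pi_eq0 /null_familyP[N [sN N0]]; exists N.
rewrite -[v]partial_value_single -partial_value_stable ?size_single_family//.
by apply: partial_value_stable0 N0; rewrite ?leq_addr.
Qed.

Lemma limit_map_surj x : exists n v, @limit_map n v = x.
Proof.
exists (size (repr x)), (partial_value (size (repr x)) (repr x)).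
by rewrite limit_map_partial_value// reprK.
Qed.

Definition limit_cone : set limit_group :=
  [set x | exists n v, simplicial_cone v /\ @limit_map n v = x].

Hypothesis A_ge0 : forall n i j, 0 <= A n i j.

Lemma limit_ordered : ordered_group limit_cone.
Proof.
have lA := limit_map_cocone.
split.
- apply/countable_injP; exists (fun x => pickle (repr x)) => x y _ _.
  by move=> /(pcan_inj (@pickleK _)) e; rewrite -[x]reprK -[y]reprK e.
- move=> _ _ [n [v [v0 <-]]] [m [w [w0 <-]]].
  have [v' [/(_ _ _ lA) <- /(_ A_ge0 v0) v'0]] := lift_level A v (leq_addr m n).
  have [w' [/(_ _ _ lA) <- /(_ A_ge0 w0) w'0]] := lift_level A w (leq_addl n m).
  exists (n + m)%N, (v' + w'); rewrite raddfD; split=> // i; rewrite mxE; exact: addr_ge0.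
- move=> x; have [n [v <-]] := limit_map_surj x.
  exists (limit_map (\col_i Num.max 0 (v i 0))), (limit_map (\col_i Num.max 0 (- v i 0))).
  split; try by do 2!eexists; split; last reflexivity; move=> i; rewrite mxE le_max lexx.
  rewrite -raddfB; congr limit_map; apply/matrixP=> i j; rewrite !mxE (ord1 j); lia.
- apply/seteqP; split=> x /=; last first.
    by move=> ->; rewrite oppr0; split; exists 0%N, 0; split; rewrite ?raddf0// => i; rewrite mxE.
  (* If an element and its opposite come from nonnegative vectors, the sum of these dies after a
     transport. There two nonnegative vectors are opposite, hence zero. *)
  move=> [[n [v [v0 <-]]] [m [w [w0]]]].
  have [v' [/(_ _ _ lA) <- /(_ A_ge0 v0) v'0]] := lift_level A v (leq_addr m n).
  have [w' [/(_ _ _ lA) <- /(_ A_ge0 w0) w'0]] := lift_level A w (leq_addl n m).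
  move=> /eqP; rewrite -subr_eq0 opprK -raddfD => /eqP /limit_map_eq0[k].
  have t0 := transport_ge0 (k := k) A_ge0.
  rewrite raddfD => /eqP; rewrite addr_eq0 => /eqP e.
  rewrite -(transport_cocone lA k v').
  suff -> : transport A k v' = 0 by rewrite raddf0.
  apply/matrixP=> i j; rewrite (ord1 j) mxE.
  have := t0 _ _ v'0 i; have := t0 _ _ w'0 i; rewrite e mxE oppr_ge0.
  by move=> a b; apply/eqP; rewrite eq_le; apply/andP.
Qed.

Lemma limit_group_limit :
  inductive_limit A limit_cone (fun n => @limit_map n).
Proof.
apply: limit_criterion; [exact: limit_ordered| | by []| exact: limit_map_eq0].
split; last exact: limit_map_cocone.
by move=> n x x0; exists n, x.
Qed.

(** Comparison with the concrete limit: the two universal maps [f] and [g] satisfy [g (f x) = x] by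
    uniqueness, so both properties carry over to [G]. *)
Lemma inductive_limit_surj_ker (G : zmodType) (P : set G)
    (eta : forall n, {additive 'cV[int]_(d n) -> G}) :
  inductive_limit A P eta ->
  (forall x, P x -> exists n v, simplicial_cone v /\ eta n v = x) /\
  (forall n v, eta n v = 0 -> exists k, transport A k v = 0).
Proof.
move=> [oP etaC univ]; have [oQ limC univ'] := limit_group_limit.
have [f [fP fE _]] := univ _ _ _ oQ limC.
have [g [gP gE _]] := univ' _ _ _ oP etaC.
have fK x : g (f x) = x.
  have [h [_ _ hE]] := univ _ _ _ oP etaC.
  have -> : g (f x) = h x.
    apply: (hE (g \o f : {additive G -> G})) => [y /fP/gP //|n y].
    by rewrite /= fE gE.
  by rewrite -(hE (idfun : {additive G -> G})).
split.
  by move=> x /fP[n [v [v0 e]]]; exists n, v; split=> //; rewrite -[x]fK -e gE.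
by move=> n v e; apply: limit_map_eq0; rewrite -fE e raddf0.
Qed.

End ConcreteLimit.

(** * Dimension groups *)

Section Combine.
Variable G : zmodType.

Definition combine m (g : 'I_m -> G) (v : 'cV[int]_m) : G := \sum_i g i *~ v i 0.

Lemma combine_is_zmod_morphism m (g : 'I_m -> G) : zmod_morphism (combine g).
Proof.
move=> x y; rewrite /combine -sumrB; apply: eq_bigr => i _.
by rewrite !mxE mulrzBr.
Qed.
HB.instance Definition _ m (g : 'I_m -> G) := GRing.isZmodMorphism.Build _ _
  (combine g) (combine_is_zmod_morphism g).

Lemma combine_mulmx m n (g : 'I_m -> G) (f : 'I_n -> G) (B : 'M[int]_(m, n)) :
  (forall j, f j = \sum_i g i *~ B i j) -> forall c, combine g (B *m c) = combine f c.
Proof.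
move=> fE c; rewrite /combine.
transitivity (\sum_i \sum_j g i *~ (B i j * c j 0)).
  by apply: eq_bigr => i _; rewrite mxE mulrz_sumr.
rewrite exchange_big; apply: eq_bigr => j _.
by rewrite fE mulrz_suml; apply: eq_bigr => i _; rewrite mulrzA.
Qed.

Lemma combine_delta m (g : 'I_m -> G) j : combine g (delta_mx j 0) = g j.
Proof.
rewrite /combine (bigD1 j)//= mxE !eqxx mulr1z big1 ?addr0// => i ij.
by rewrite mxE (negbTE ij) mulr0z.
Qed.

Lemma additive_combine n (f : {additive 'cV[int]_n -> G}) v :
  f v = combine (fun i => f (delta_mx i 0)) v.
Proof.
rewrite [in LHS](matrix_sum_delta v) raddf_sum; apply: eq_bigr => i _.
by rewrite big_ord1 -[v i 0 in LHS]intz scaler_int raddfMz.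
Qed.

End Combine.

Section DimensionGroup.
Variables (G : zmodType) (P : set G).
Hypothesis dimG : dimension_group P.

(** Lifts are provided at all sufficiently high levels, so that finitely many elements can be lifted
    to the same one. *)
Lemma dim_presentation : exists (d : nat -> nat) (A : forall n, 'M[int]_(d n.+1, d n))
    (eta : forall n, {additive 'cV[int]_(d n) -> G}),
  [/\ forall n i j, 0 <= A n i j,
      forall n x, eta n.+1 (A n *m x) = eta n x,
      forall n v, simplicial_cone v -> P (eta n v),
      forall n v, eta n v = 0 -> exists k, transport A k v = 0
    & forall x, exists N, forall M, (N <= M)%N -> exists v,
        eta M v = x /\ (P x -> simplicial_cone v)].
Proof.
have [[_ _ gen _] [d [A [eta [A0 lim]]]]] := dimG; exists d, A, eta.
have [sur ker] := inductive_limit_surj_ker A0 lim; have [_ [etaP etaA] _] := lim.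
split=> // x; have [Px|nPx] := EM (P x).
  have [n [v [v0 <-]]] := sur x Px; exists n => M /(lift_level A v)[w [we wp]].
  by exists w; split; [rewrite we | move=> _; apply: wp].
have [_ [_ [/sur[n [y [_ <-]]] /sur[m [z [_ <-]]] e]]] := gen x.
exists (n + m)%N => M; rewrite addnC => nmM.
have [y' [ye _]] := lift_level A y (leq_trans (leq_addl m n) nmM).
have [z' [ze _]] := lift_level A z (leq_trans (leq_addr n m) nmM).
by exists (y' - z'); rewrite raddfB/= ye// ze.
Qed.

(** At a high enough level the lift of the multiple is the multiple of the lift, and positivity is
    read off coordinatewise. *)
Lemma dim_unperforated m x : P (x *+ m.+1) -> P x.
Proof.
have [d [A [eta [A0 etaA etaP ker lift]]]] := dim_presentation => Pmx.
have [N /(_ _ (leqnn N))[w [we wp]]] := lift (x *+ m.+1).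
have [N' /(_ _ (leq_addl N N'))[v [ve _]]] := lift x.
have [w' [/(_ _ _ etaA) we' /(_ A0 (wp Pmx)) wp']] := lift_level A w (leq_addr N' N).
have /ker[k] : eta _ (v *+ m.+1 - w') = 0.
  by rewrite raddfB raddfMn /= ve we' we subrr.
rewrite raddfB raddfMn => /eqP; rewrite subr_eq0 => /eqP e.
rewrite -ve -(transport_cocone etaA k v); apply: etaP => i.
have := transport_ge0 (k := k) A0 wp' i; rewrite -e mulmxnE.
by rewrite pmulrn_lge0.
Qed.

(** Once the relation holds between vectors of one level, the coordinatewise minimum of the lifts of
    [x] and [y] serves as their common part. *)
Lemma dim_riesz x x' y z : P x -> P x' -> P y -> P z -> x + x' = y + z ->
  exists y1 y2 z1 z2, [/\ [/\ P y1, P y2, P z1 & P z2],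
    x = y1 + z1, x' = y2 + z2, y = y1 + y2 & z = z1 + z2].
Proof.
have [d [A [eta [A0 etaA etaP ker lift]]]] := dim_presentation => Px Px' Py Pz e.
have [Nx lx] := lift x; have [Nx' lx'] := lift x'.
have [Ny ly] := lift y; have [Nz lz] := lift z.
pose N := (Nx + Nx' + Ny + Nz)%N.
have {lx}[u [ue /(_ Px)u0]] : exists v, eta N v = x /\ (P x -> simplicial_cone v).
  by apply: lx; rewrite /N; lia.
have {lx'}[u' [ue' /(_ Px')u0']] : exists v, eta N v = x' /\ (P x' -> simplicial_cone v).
  by apply: lx'; rewrite /N; lia.
have {ly}[v [ve /(_ Py)v0]] : exists v, eta N v = y /\ (P y -> simplicial_cone v).
  by apply: ly; rewrite /N; lia.
have {lz}[w [we /(_ Pz)w0]] : exists v, eta N v = z /\ (P z -> simplicial_cone v).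
  by apply: lz; rewrite /N; lia.
have /ker[k] : eta N (u + u' - (v + w)) = 0.
  by rewrite raddfB !raddfD /= ue ue' ve we -opprD e subrr.
rewrite raddfB !raddfD -opprD /= => /eqP; rewrite subr_eq0 => /eqP.
move/(transport_ge0 (k := k) A0): u0; move/(transport_ge0 (k := k) A0): u0'.
move/(transport_ge0 (k := k) A0): v0; move/(transport_ge0 (k := k) A0): w0.
rewrite -ue -ue' -ve -we -(transport_cocone etaA k u) -(transport_cocone etaA k u').
rewrite -(transport_cocone etaA k v) -(transport_cocone etaA k w).
move: (transport _ _ u) (transport _ _ u') (transport _ _ v) (transport _ _ w).
move=> {ue ue' ve we} {}u {}u' {}v {}w w0 v0 u'0 u0 uvw.
pose m := \col_i Num.min (u i 0) (v i 0).
exists (eta _ m), (eta _ (v - m)), (eta _ (u - m)), (eta _ (u' - (v - m))).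
have E i : u i 0 + u' i 0 = v i 0 + w i 0.
  by have /matrixP/(_ i 0) := uvw; rewrite !mxE.
split.
- split; apply: etaP => i; rewrite !mxE; have := E i; have := w0 i; have := v0 i;
  have := u0 i; have := u'0 i; case: (lerP (u i 0) (v i 0)); lra.
- by rewrite -raddfD /= addrC subrK.
- by rewrite -raddfD /= addrC subrK.
- by rewrite -raddfD /= addrC subrK.
- rewrite -raddfD; congr (eta _ _); apply/matrixP=> i j; rewrite (ord1 j) !mxE.
  have := E i; lra.
Qed.

Lemma transport_mulmx (d : nat -> nat) (A : forall n, 'M[int]_(d n.+1, d n)) n k :
  exists T, forall x, @transport d A n k x = T *m x.
Proof.
elim: k => [|k [T TE]]; first by exists 1%:M => x; rewrite mul1mx.
by exists (A (k + n)%N *m T) => x; rewrite -mulmxA -TE.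
Qed.

(* Lift [f] to a level of a presentation of [G] at which the rank of the lift
   is minimal: the kernel of the lift cannot grow any more. *)
Lemma dim_factor m (f : 'I_m -> G) : exists p (h : 'I_p -> G) (B : 'M[int]_(p, m)),
  (forall j, f j = \sum_k h k *~ B k j) /\ (forall c, combine f c = 0 -> B *m c = 0).
Proof.
have [d [A [eta [A0 etaA etaP ker lift]]]] := dim_presentation.
pose lifts r := exists N (B : 'M[int]_(d N, m)), (forall j, eta N (col j B) = f j) /\
  \rank (map_mx (fun z : int => z%:~R : rat) B) = r.
have ex_r : exists r, `[< lifts r >].
  have [N NE] := choice (fun j => lift (f j)).
  have [v vE] := choice (fun j => NE j _ (leq_bigmax j)).
  eexists; apply/asboolP; exists (\max_j N j), (\matrix_(i, j) v j i 0).
  split; last reflexivity.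
  move=> j; have [<- _] := vE j; congr (eta _ _); apply/matrixP=> i k.
  by rewrite (ord1 k) !mxE.
have [r /asboolP[N [B [BE rB]]] rmin] := ex_minnP ex_r.
have fE c : eta N (B *m c) = combine f c.
  rewrite additive_combine; apply: combine_mulmx => j.
  rewrite -BE additive_combine; apply: eq_bigr => i _.
  by rewrite mxE.
exists (d N), (fun i => eta N (delta_mx i 0)), B; split.
  by move=> j; rewrite -BE additive_combine; apply: eq_bigr => i _; rewrite mxE.
move=> c; rewrite -fE => /ker[k]; have [T TE] := transport_mulmx A N k.
rewrite TE mulmxA => TBc.
pose ratm p q := @map_mx int rat (fun z : int => z%:~R) p q.
have le : (ratm _ _ (T *m B) <= ratm _ _ B)%MS by rewrite /ratm map_mxM submxMl.
have rTB : (\rank (ratm _ _ B) <= \rank (ratm _ _ (T *m B)))%N.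
  rewrite {1}rB; apply: rmin; apply/asboolP; exists (k + N)%N, (T *m B).
  by split=> // j; rewrite -BE -[RHS](transport_cocone etaA k) TE !colE mulmxA.
(* By minimality of the rank the row spaces agree over the rationals, so [B] vanishes wherever
   [T *m B] does. *)
have /submxP[D DE] : (ratm _ _ B <= ratm _ _ (T *m B))%MS.
  by rewrite -(mxrank_leqif_sup le) eqn_leq rTB mxrankS.
suff: ratm _ _ (B *m c) = 0.
  move=> /matrixP z; apply/matrixP=> i j; have := z i j; rewrite !mxE => /eqP.
  by rewrite intr_eq0 => /eqP.
by rewrite /ratm map_mxM -/(ratm _ _) DE -mulmxA -map_mxM TBc map_mx0 mulmx0.
Qed.

End DimensionGroup.

(** * States and extremal states *)

Lemma morph_additive (G H : zmodType) (f : G -> H) : {morph f : x y / x + y} ->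
  exists F : {additive G -> H}, (F : G -> H) = f.
Proof.
move=> fD; have f0 : f 0 = 0.
  by apply: (@addIr _ (f 0)); rewrite -fD !add0r.
have fB : zmod_morphism f.
  by move=> x y; apply: (@addIr _ (f y)); rewrite -fD !subrK.
pose fM := GRing.isZmodMorphism.Build G H f fB.
by exists (HB.pack f fM : {additive G -> H}).
Qed.

Section OrderedGroup.
Variables (G : zmodType) (P : set G).
Hypothesis ordG : ordered_group P.

Lemma cone0 : P 0.
Proof.
have [_ _ _ PN] := ordG.
by have [] : [set x | P x /\ P (- x)] 0 by rewrite PN.
Qed.

Lemma coneD x y : P x -> P y -> P (x + y).
Proof. by have [_ + _ _] := ordG; apply. Qed.

Lemma coneMn x n : P x -> P (x *+ n).
Proof.
by move=> Px; elim: n => [|n IH]; rewrite ?mulr0n ?mulrS; [apply: cone0|apply: coneD].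
Qed.

(** The elements lying between two opposite multiples of [x] form an order ideal that contains
    [x]. *)
Lemma simple_order_unit x : simple_group P -> P x -> x <> 0 -> order_unit P x.
Proof.
move=> simpleG Px x0; pose I := [set y | exists k, P (x *+ k - y) /\ P (x *+ k + y)].
have idealI : order_ideal P I.
  split.
  - by exists 0%N; rewrite subr0 addr0; split; apply: cone0.
  - move=> y z [k [Pk Pk']] [l [Pl Pl']]; exists (k + l)%N; rewrite mulrnDr; split.
      by rewrite opprB [z - y]addrC addrACA; apply: coneD.
    by rewrite addrACA; apply: coneD.
  - move=> y [k [Pk Pk']]; exists (x *+ k + y), (x *+ k).
    have Pxk := coneMn k Px.
    split; [split=> // |split=> //|by rewrite addrC addKr].
      exists (k + k)%N; rewrite mulrnDr opprD addrACA subrr add0r; split=> //.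
      by rewrite -addrA; apply: coneD => //; apply: coneD.
    by exists k; rewrite subrr; split; [apply: cone0|apply: coneD].
  - move=> a b Pa Pba [k [Pk Pk']]; exists k; split.
      by rewrite -[x *+ k](subrK b) -addrA; apply: coneD.
    by apply: coneD => //; apply: coneMn.
have Ix : I x by exists 1%N; rewrite subrr; split; [apply: cone0 | apply: coneD].
have [I0|IT] := simpleG I idealI; first by rewrite I0 in Ix.
split=> // a; have [k [Pk _]] : I a by rewrite IT.
by exists k.+1; split=> //; rewrite mulrS -addrA; apply: coneD.
Qed.

Lemma state_gt0 (R : realType) (e : G) (tau : G -> R) x :
  simple_group P -> states P e tau -> P x -> x <> 0 -> 0 < tau x.
Proof.
move=> simpleG [/morph_additive[F <-] Fp Fe] Px x0.
have [_ /(_ e)[k [k0 /Fp]]] := simple_order_unit simpleG Px x0.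
rewrite raddfB raddfMn /= Fe subr_ge0 => le1.
by rewrite -(pmulrn_lgt0 _ k0) (lt_le_trans ltr01).
Qed.

End OrderedGroup.

(** * Sublinear functionals on abelian groups *)

Section Sublinear.
Variables (R : realType) (G : zmodType).

Definition sublinear (p : G -> R) : Prop :=
  (forall x y, p (x + y) <= p x + p y) /\ (forall x n, p (x *+ n) = p x *+ n).

(* The supremum over the face of [{tau additive | tau <= p}] on which [tau x] is
   maximal, i.e. on which [tau x = p x]. *)
Definition tighten (p : G -> R) (x y : G) : R :=
  inf (range (fun n => p (y + x *+ n) - p x *+ n)).

(** Subadditivity yields the other half of homogeneity. *)
Lemma sublinearI (p : G -> R) : (forall x y, p (x + y) <= p x + p y) -> p 0 = 0 ->
  (forall x n, p x *+ n.+1 <= p (x *+ n.+1)) -> sublinear p.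
Proof.
move=> pD p0 pM; split=> // x [|n]; first by rewrite !mulr0n.
apply/eqP; rewrite eq_le pM andbT.
elim: n => [|n IH]; first by rewrite !mulr1n.
by rewrite mulrS [leRHS]mulrS (le_trans (pD _ _))// lerD2l.
Qed.

Variables (p : G -> R) (sub_p : sublinear p).

Lemma sublinear0 : p 0 = 0.
Proof. by have [_ /(_ 0 0%N)] := sub_p; rewrite !mulr0n. Qed.

Lemma sublinear_geN y : - p (- y) <= p y.
Proof.
by have [/(_ y (- y)) + _] := sub_p; rewrite subrr sublinear0; lra.
Qed.

Lemma tighten_lbound x y : lbound (range (fun n => p (y + x *+ n) - p x *+ n)) (- p (- y)).
Proof.
move=> _ [n _ <-]; have [/(_ (y + x *+ n) (- y)) + pM] := sub_p.
rewrite addrAC subrr add0r pM; lra.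
Qed.

Lemma tighten_leP x y n : tighten p x y <= p (y + x *+ n) - p x *+ n.
Proof. by apply: ge_inf; [exists (- p (- y)); apply: tighten_lbound | exists n]. Qed.

Lemma le_tighten x y a :
  (forall n, a <= p (y + x *+ n) - p x *+ n) -> a <= tighten p x y.
Proof.
move=> le; apply: lb_le_inf; first by eexists; exists 0%N.
by move=> _ [n _ <-].
Qed.

Lemma tighten_le x y : tighten p x y <= p y.
Proof. by have := tighten_leP x y 0; rewrite !mulr0n addr0 subr0. Qed.

Lemma tightenN x : tighten p x (- x) <= - p x.
Proof. by have := tighten_leP x (- x) 1; rewrite addNr sublinear0 sub0r. Qed.

Lemma tighten_sublinear x : sublinear (tighten p x).
Proof.
have [pD pM] := sub_p.
have tD y z : tighten p x (y + z) <= tighten p x y + tighten p x z.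
  rewrite -lerBlDl; apply: le_tighten => m; rewrite lerBlDl -lerBlDr.
  apply: le_tighten => n; rewrite lerBlDr.
  apply: (le_trans (tighten_leP x _ (n + m)%N)); rewrite mulrnDr addrACA.
  apply: (@le_trans _ _ (p (y + x *+ n) + p (z + x *+ m) - p x *+ (n + m))).
    by rewrite lerD2r.
  by rewrite mulrnDr; lra.
have t0 : tighten p x 0 = 0.
  apply/eqP; rewrite eq_le; apply/andP; split.
    by rewrite -[leRHS]sublinear0 tighten_le.
  by apply: le_tighten => n; rewrite add0r pM subrr.
apply: sublinearI => // y j.
apply: le_tighten => n.
apply: (@le_trans _ _ ((p (y + x *+ n) - p x *+ n) *+ j.+1)).
  by apply: ler_wMn2r; apply: tighten_leP.
rewrite mulrnBl -[p (y + _) *+ _]pM mulrnDl -!mulrnA.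
(* Of the [n * j.+1] copies of [x], all but [n] are split off; their cost is the matching part of
   the subtracted term. *)
have := pD (y *+ j.+1 + x *+ n) (x *+ (n * j)).
rewrite -addrA -mulrnDr -mulnS pM.
have -> : p x *+ (n * j.+1) = p x *+ n + p x *+ (n * j) by rewrite mulnS mulrnDr.
lra.
Qed.

End Sublinear.

(** * Lexicographically maximal states *)

Section ExtremalState.
Variables (R : realType) (G : zmodType) (P : set G) (e : G).
Hypothesis ordG : ordered_group P.
Hypothesis unit_e : order_unit P e.
Hypothesis unperforated : forall m (x : G), P (x *+ m.+1) -> P x.
Variables (tau0 : G -> R) (state_tau0 : states P e tau0).

(* By Hahn-Banach, the supremum of [tau x] over the states [tau]. *)
Definition state_bounds (x : G) : set R :=
  [set r | exists (k : int) m,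
    [/\ (0 < m)%N, P (e *~ k - x *+ m) & r = k%:~R / m%:R]].

Definition state_sup (x : G) : R := inf (state_bounds x).

Lemma state_le_bound tau x r : states P e tau -> state_bounds x r -> tau x <= r.
Proof.
move=> [/morph_additive[F <-] Fp Fe] [k [m [m0 /Fp]]] + ->.
rewrite raddfB raddfMn raddfMz /= Fe -[F x *+ m]mulr_natr => le.
by rewrite ler_pdivlMr ?ltr0n// -subr_ge0.
Qed.

Lemma state_sup_le k m x : (0 < m)%N -> P (e *~ k - x *+ m) ->
  state_sup x <= k%:~R / m%:R.
Proof.
move=> m0 Pk; apply: ge_inf; last by exists k, m.
by exists (tau0 x) => r; apply: state_le_bound.
Qed.

Lemma le_state_sup x a : (forall r, state_bounds x r -> a <= r) -> a <= state_sup x.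
Proof.
move=> le; apply: lb_le_inf => //.
have [_ /(_ x)[k [k0 Pk]]] := unit_e.
by exists (k%:~R / 1%:R), k%:Z, 1%N; rewrite mulr1n pmulrn.
Qed.

Lemma state_le_sup tau x : states P e tau -> tau x <= state_sup x.
Proof. by move=> st; apply: le_state_sup => r; apply: state_le_bound. Qed.

Lemma state_sup_sublinear : sublinear state_sup.
Proof.
apply: sublinearI => [x y||x n].
- rewrite -lerBlDl; apply: le_state_sup => _ [l [n [n0 Pn ->]]].
  rewrite lerBlDl -lerBlDr; apply: le_state_sup => _ [k [m [m0 Pm ->]]].
  rewrite lerBlDr.
  have -> : k%:~R / m%:R + l%:~R / n%:R = (k * n%:Z + l * m%:Z)%:~R / (m * n)%:R :> R.
    by rewrite natrM addf_div ?pnatr_eq0 -?lt0n// intrD !intrM.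
  apply: state_sup_le; first by rewrite muln_gt0 m0.
  have -> : e *~ (k * n%:Z + l * m%:Z) - (x + y) *+ (m * n) =
            (e *~ k - x *+ m) *+ n + (e *~ l - y *+ n) *+ m.
    rewrite mulrzDr !mulrzA -!pmulrn !mulrnBl -!mulrnA (mulnC n m) mulrnDl opprD.
    by rewrite addrACA.
  by apply: coneD => //; apply: coneMn.
- apply/eqP; rewrite eq_le; apply/andP; split.
    rewrite -[leRHS](mul0r (1%:R^-1)); apply: (@state_sup_le 0 1) => //.
    by rewrite mulr0z mul0rn subrr; apply: cone0.
  (* The given state keeps the infimum at 0 from being negative. *)
  have := state_le_sup 0 state_tau0.
  by have [/morph_additive[F <-] _ _] := state_tau0; rewrite raddf0.
- apply: le_state_sup => _ [k [m [m0 Pm ->]]].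
  rewrite -[state_sup x *+ _]mulr_natr -ler_pdivlMr ?ltr0n// -mulrA -invfM -natrM.
  by apply: state_sup_le; rewrite ?muln_gt0 ?m0// mulnC mulrnA.
Qed.

Section Enumeration.
Variable x : nat -> G.
Hypothesis x_surj : forall y, exists n, x n = y.

(** Pass [n] restricts to the face on which the value at [x n] is maximal among the states kept so
    far. *)
Fixpoint tightened n : G -> R :=
  if n is n'.+1 then tighten (tightened n') (x n') else state_sup.

Lemma tightened_sublinear n : sublinear (tightened n).
Proof. by elim: n => [|n IH]; [exact: state_sup_sublinear | exact: tighten_sublinear]. Qed.

Lemma tightened_le m n y : (m <= n)%N -> tightened n y <= tightened m y.
Proof.
move=> /subnK <-; elim: (n - m)%N => //= k; apply: le_trans.
by apply: tighten_le; apply: tightened_sublinear.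
Qed.

Definition lex_state (y : G) : R := inf (range (fun n => tightened n y)).

Lemma lex_state_le n y : lex_state y <= tightened n y.
Proof.
apply: ge_inf; last by exists n.
exists (- state_sup (- y)) => _ [m _ <-].
apply: le_trans (sublinear_geN (tightened_sublinear m) y).
by rewrite lerN2; apply: (@tightened_le 0).
Qed.

Lemma le_lex_state a y : (forall n, a <= tightened n y) -> a <= lex_state y.
Proof.
move=> le; apply: lb_le_inf; first by eexists; exists 0%N.
by move=> _ [n _ <-].
Qed.

(** The sequence decreases, so near-optimal indices for [y] and for [z] can both be replaced by
    their sum. *)
Lemma lex_state_subadditive y z : lex_state (y + z) <= lex_state y + lex_state z.
Proof.
rewrite -lerBlDl; apply: le_lex_state => n; rewrite lerBlDl -lerBlDr.
apply: le_lex_state => m; rewrite lerBlDr.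
apply: le_trans (lex_state_le (m + n) _) _.
have [/(_ y z) + _] := tightened_sublinear (m + n).
move=> /le_trans; apply; apply: lerD; apply: tightened_le; lia.
Qed.

(** After the pass for [y = x n], the functional at [- y] is at most the negative of its former
    value at [y]. Since every element is enumerated, the limit is odd, hence additive. *)
Lemma lex_stateN y : lex_state (- y) = - lex_state y.
Proof.
apply/eqP; rewrite eq_le; apply/andP; split.
  have [n <-] := x_surj y; apply: le_trans (lex_state_le n.+1 _) _ => /=.
  apply: le_trans (tightenN (tightened_sublinear n) _) _.
  by rewrite lerN2 lex_state_le.
have := lex_state_subadditive y (- y); rewrite subrr.
have : 0 <= lex_state 0.
  by apply: le_lex_state => n; rewrite (sublinear0 (tightened_sublinear n)).
lra.
Qed.

Lemma lex_stateD : {morph lex_state : y z / y + z}.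
Proof.
move=> y z; apply/eqP; rewrite eq_le lex_state_subadditive /=.
by have := lex_state_subadditive (y + z) (- z); rewrite addrK lex_stateN; lra.
Qed.

Lemma lex_state_x n : lex_state (x n) = tightened n (x n).
Proof.
apply/eqP; rewrite eq_le lex_state_le /=.
have := lex_state_le n.+1 (- x n); rewrite lex_stateN /=.
by have := tightenN (tightened_sublinear n) (x n); lra.
Qed.

(** If the limit is a proper convex combination of two states, both stay below every [tightened n],
    hence below the limit; additive functions so ordered coincide. *)
Lemma lex_state_extremal : extremal_states P e lex_state.
Proof.
have D := lex_stateD; split.
  have le k m y : (0 < m)%N -> P (e *~ k - y *+ m) -> lex_state y <= k%:~R / m%:R.
    by move=> m0 Pk; apply: le_trans (lex_state_le 0 _) _; apply: state_sup_le.
  split=> //.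
    move=> y Py; rewrite -[y]opprK lex_stateN oppr_ge0.
    rewrite -[leRHS](mul0r (1%:R^-1)); apply: (le 0 1%N) => //.
    by rewrite mulr0z mulr1n sub0r opprK.
  have := le 1 1%N e; have := le (-1) 1%N (- e).
  rewrite lex_stateN !mulr1z !mulrN1z !mulr1n opprK addNr subrr !divr1.
  move=> /(_ isT (cone0 ordG)) + /(_ isT (cone0 ordG)); lra.
move=> a b t sa sb /andP[t0 t1] E.
have Ey y : lex_state y = t * a y + (1 - t) * b y by rewrite E.
have le n : (forall y, a y <= tightened n y) /\ (forall y, b y <= tightened n y).
  elim: n => [|n [aIH bIH]]; first by split=> y; apply: state_le_sup.
  have := Ey (x n); rewrite lex_state_x => En.
  (* The combination attains at [x n] the upper bound common to [a] and [b], so each of them attains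
     it and survives the next pass. *)
  have an : a (x n) = tightened n (x n).
    by have := aIH (x n); have := bIH (x n); nra.
  have bn : b (x n) = tightened n (x n).
    by have := aIH (x n); have := bIH (x n); nra.
  have [/morph_additive[A EA] _ _] := sa; have [/morph_additive[B EB] _ _] := sb.
  split=> y /=; apply: le_tighten => m.
    by have := aIH (y + x n *+ m); rewrite -an -EA raddfD raddfMn /=; lra.
  by have := bIH (y + x n *+ m); rewrite -bn -EB raddfD raddfMn /=; lra.
have eqst c : states P e c -> (forall y, c y <= lex_state y) -> c = lex_state.
  move=> [/morph_additive[C <-] _ _] le'; apply/funext => y.
  have := le' y; have := le' (- y); rewrite lex_stateN raddfN /=.
  by move=> *; apply/eqP; rewrite eq_le; apply/andP; split; lra.
by split; apply: eqst => // y; apply: le_lex_state => n; apply le.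
Qed.

End Enumeration.

(* Maximize lexicographically over an enumeration of [G] starting with [- g]. *)
Lemma extremal_state_le0 (g : G) : ~ P g ->
  exists tau : G -> R, extremal_states P e tau /\ tau g <= 0.
Proof.
move=> nPg; have [/countable_injP[code code_inj] _ _ _] := ordG.
(* The shift by one makes room for [- g] in front; codes that are not taken are sent to 0. *)
pose x n := if n is n'.+1 then
    if pselect (exists y, code y = n') is left ex then projT1 (cid ex) else 0
  else - g.
have x_surj y : exists n, x n = y.
  exists (code y).+1; rewrite /x; case: pselect => [ex|[]]; last by exists y.
  by case: cid => z /= e'; apply: code_inj; rewrite ?inE.
exists (lex_state x); split; first exact: lex_state_extremal.
have := lex_state_x x_surj 0; rewrite (lex_stateN x_surj) /= => E.
rewrite -oppr_ge0 E; apply: le_state_sup => r [k [m [m0]]].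
rewrite mulNrn opprK => Pk ->; apply: divr_ge0 => //; rewrite ler0z leNgt.
apply/negP => k0; apply: nPg; apply: (@unperforated m.-1); rewrite prednK//.
(* A negative bound on the supremum at [- g] would write a multiple of [g] as a sum of positive
   elements, against unperforation. *)
have -> : g *+ m = (e *~ k + g *+ m) + e *+ `|k|%N.
  have k_abs : k + `|k|%N%:Z = 0 by lia.
  by rewrite [e *+ _]pmulrn addrAC -mulrzDr k_abs mulr0z add0r.
by apply: coneD => //; apply: coneMn => //; case: unit_e.
Qed.

End ExtremalState.

(** * Density of the image of the extremal states *)

Lemma floor_exists (R : realType) (x : R) : exists k : int, k%:~R <= x < k%:~R + 1.
Proof.
exists (Num.floor x); rewrite ge_floor /=.
by have := floorD1_gt x; rewrite intrD.
Qed.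

Section ExtremalDomination.
Variables (R : realType) (G : zmodType) (P : set G) (e : G).
Hypothesis unit_e : order_unit P e.

Lemma positive_eq0 (F : {additive G -> R}) :
  (forall x, P x -> 0 <= F x) -> F e = 0 -> forall x, F x = 0.
Proof.
move=> Fp Fe x; have [_ unit] := unit_e.
have [k [_ /Fp]] := unit x; have [l [_ /Fp]] := unit (- x).
rewrite !raddfB !raddfMn raddfN /= Fe !mul0rn => *; lra.
Qed.

(** For [0 < F e < 1], [sigma] is the convex combination, with weight [F e], of the normalizations
    of [F] and [sigma - F]. At the end values, [F] or [sigma - F] vanishes at the order unit, hence
    everywhere. *)
Lemma extremal_dominated (sigma : G -> R) (F : {additive G -> R}) :
  extremal_states P e sigma -> (forall x, P x -> 0 <= F x <= sigma x) ->
  forall x, F x = F e * sigma x.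
Proof.
move=> [[/morph_additive[S SE] sp se] ext] Fs x; have [Pe _] := unit_e.
pose D : {additive G -> R} := S \- F.
have DE y : D y = sigma y - F y by rewrite /= SE.
have Fp y : P y -> 0 <= F y by move=> /Fs/andP[].
have Dp y : P y -> 0 <= D y by move=> /Fs/andP[]; rewrite DE subr_ge0.
have [F0 F1] : 0 <= F e /\ F e <= 1 by have /andP[] := Fs e Pe; rewrite se.
have [Fe0|Fe0] := eqVneq (F e) 0; first by rewrite Fe0 mul0r positive_eq0.
have [Fe1|Fe1] := eqVneq (F e) 1.
  have := positive_eq0 Dp _ x; rewrite DE se Fe1 subrr => /(_ erefl).
  by rewrite DE => /eqP; rewrite subr_eq0 mul1r => /eqP.
have De : 1 - F e != 0 by rewrite subr_eq0 eq_sym.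
pose a y := (F e)^-1 * F y; pose b y := (1 - F e)^-1 * D y.
have sa : states P e a.
  split; first by move=> y z; rewrite /a raddfD mulrDr.
    by move=> y /Fp ?; rewrite /a mulr_ge0// invr_ge0.
  by rewrite /a mulVf.
have sb : states P e b.
  split; first by move=> y z; rewrite /b raddfD mulrDr.
    by move=> y /Dp ?; rewrite /b mulr_ge0// invr_ge0 subr_ge0.
  by rewrite /b DE se mulVf.
have [|| aE _] := ext a b (F e) sa sb.
- by rewrite !lt_neqAle eq_sym Fe0 F0 Fe1 F1.
- apply/funext => y; rewrite /a /b -[RHS]/(F e * _ + (1 - F e) * _).
  by rewrite !mulrA !mulfV// !mul1r DE addrC subrK.
by rewrite -aE /a mulrA mulfV// mul1r.
Qed.

End ExtremalDomination.

(** * The infimum of two distinct extremal states *)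

Section StateMeet.
Variables (R : realType) (G : zmodType) (P : set G) (e : G) (sigma1 sigma2 : G -> R).
Hypotheses (dimG : dimension_group P) (simpleG : simple_group P).
Hypothesis unit_e : order_unit P e.
Hypotheses (ext1 : extremal_states P e sigma1) (ext2 : extremal_states P e sigma2).
Hypothesis sigma12 : sigma1 <> sigma2.

Let ordG : ordered_group P. Proof. by have [] := dimG. Qed.

Definition splittings (x : G) : set R :=
  [set r | exists y z, [/\ P y, P z, x = y + z & r = sigma1 y + sigma2 z]].

(* On the cone, the restriction of the infimum of [sigma1] and [sigma2] among
   additive functions. *)
Definition state_meet (x : G) : R := inf (splittings x).

Lemma state_meet_le x y z : P y -> P z -> x = y + z -> state_meet x <= sigma1 y + sigma2 z.
Proof.
have [[_ s1 _] _] := ext1; have [[_ s2 _] _] := ext2.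
move=> Py Pz xE; apply: ge_inf; last by exists y, z.
by exists 0 => _ [y' [z' [Py' Pz' _ ->]]]; rewrite addr_ge0 ?s1 ?s2.
Qed.

Lemma le_state_meet x a : P x ->
  (forall y z, P y -> P z -> x = y + z -> a <= sigma1 y + sigma2 z) -> a <= state_meet x.
Proof.
move=> Px le; apply: lb_le_inf.
  by exists (sigma1 x + sigma2 0), x, 0; split; rewrite ?addr0//; apply: cone0.
by move=> _ [y [z [Py Pz xE ->]]]; apply: le.
Qed.

(** Splittings add up; conversely, Riesz decomposition breaks a splitting of the sum into splittings
    of the terms. *)
Lemma state_meetD x x' : P x -> P x' -> state_meet (x + x') = state_meet x + state_meet x'.
Proof.
have [[D1 _ _] _] := ext1; have [[D2 _ _] _] := ext2.
move=> Px Px'; apply/eqP; rewrite eq_le; apply/andP; split.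
  rewrite -lerBlDl; apply: le_state_meet => // y' z' Py' Pz' x'E; rewrite lerBlDl -lerBlDr.
  apply: le_state_meet => // y z Py Pz xE; rewrite lerBlDr.
  rewrite addrACA -D1 -D2; apply: state_meet_le; try exact: coneD.
  by rewrite xE x'E addrACA.
apply: le_state_meet => [|y z Py Pz E]; first exact: coneD.
have [y1 [y2 [z1 [z2 [[Py1 Py2 Pz1 Pz2] xE x'E -> ->]]]]] := dim_riesz dimG Px Px' Py Pz E.
by rewrite D1 D2 addrACA; apply: lerD; apply: state_meet_le.
Qed.

(** The additive extension of the infimum is dominated by both extremal states, so it is the same
    multiple of each; as they differ, that multiple is zero. *)
Lemma state_meet_eq0 x : P x -> state_meet x = 0.
Proof.
move=> Px; have [_ _ gen _] := ordG.
(* Fix one difference of positive elements for each element; additivity on the cone makes the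
   resulting [tau] additive on [G]. *)
have [p pE] := choice gen; have [q pqE] := choice pE.
have Pp y : P (p y) by case: (pqE y).
have Pq y : P (q y) by case: (pqE y).
have E y : y + q y = p y by have [_ _ {1}->] := pqE y; rewrite subrK.
pose tau y := state_meet (p y) - state_meet (q y).
have tauD : {morph tau : y z / y + z}.
  move=> y z; have : p (y + z) + (q y + q z) = p y + p z + q (y + z).
    by rewrite -!E addrAC addrACA.
  move=> /(congr1 state_meet).
  rewrite !state_meetD//; try exact: coneD.
  rewrite /tau; lra.
have tauE y : P y -> tau y = state_meet y.
  by move=> Py; rewrite /tau -E state_meetD// addrK.
have [T TE] := morph_additive tauD.
have [[_ s1 e1] _] := ext1; have [[_ s2 e2] _] := ext2; have [Pe _] := unit_e.
have P0 := cone0 ordG.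
have sig0 (s : G -> R) : extremal_states P e s -> s 0 = 0.
  by move=> [[/morph_additive[S <-] _ _] _]; rewrite raddf0.
have T1 y : P y -> 0 <= T y <= sigma1 y.
  move=> Py; rewrite TE tauE//; apply/andP; split.
    by apply: le_state_meet => // u v /s1 ? /s2 ? _; rewrite addr_ge0.
  by rewrite -[leRHS]addr0 -(sig0 _ ext2); apply: state_meet_le; rewrite ?addr0.
have T2 y : P y -> 0 <= T y <= sigma2 y.
  move=> Py; have /andP[-> _] := T1 y Py; rewrite TE tauE//.
  by rewrite -[leRHS]add0r -(sig0 _ ext1); apply: state_meet_le; rewrite ?add0r.
have Te : T e = 0.
  apply: contra_notP sigma12 => /eqP Te; apply/funext => y; apply: (mulfI Te).
  by rewrite -(extremal_dominated unit_e ext1 T1) -(extremal_dominated unit_e ext2 T2).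
by rewrite -tauE// -TE (extremal_dominated unit_e ext1 T1) Te mul0r.
Qed.

(** As the infimum at [f] is 0, [f = y + z] with [sigma1 y] and [sigma2 z] tiny; then [z] carries
    almost all of [sigma1 f]. *)
Lemma lopsided_below f (d : R) : P f -> f <> 0 -> 0 < d ->
  exists g, [/\ P g, P (f - g), g <> 0 & sigma2 g < d * sigma1 g].
Proof.
move=> Pf f0 d0.
have [[D1 s1 _] _] := ext1; have [[D2 s2 _] _] := ext2.
have sf : 0 < sigma1 f by apply: (state_gt0 ordG simpleG (proj1 ext1) Pf f0).
(* From [sigma1 y + sigma2 z < t] follows [sigma2 z + d * sigma1 y < d * sigma1 f], which is the
   claim for [z]. *)
pose t := d * sigma1 f / (1 + d).
have tE : t * (1 + d) = d * sigma1 f by rewrite /t mulfVK// gt_eqF// addr_gt0.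
have t0 : 0 < t by rewrite /t divr_gt0 ?mulr_gt0 ?addr_gt0.
have [y [z [Py Pz fE lt]]] : exists y z, [/\ P y, P z, f = y + z & sigma1 y + sigma2 z < t].
  apply: contrapT => nex; suff : t <= 0 by rewrite leNgt t0.
  rewrite -(state_meet_eq0 Pf); apply: le_state_meet => // y z Py Pz fE.
  by rewrite leNgt; apply/negP => lt; apply: nex; exists y, z.
have := s1 y Py; have := s2 z Pz; have fD : sigma1 f = sigma1 y + sigma1 z by rewrite fE D1.
move=> z0 y0; exists z; split; rewrite ?fE ?addrK//; last by nra.
move=> z0'; have : sigma1 z = 0.
  by rewrite z0'; have [[/morph_additive[S <-] _ _] _] := ext1; rewrite raddf0.
move: fD; clear -lt tE sf d0 z0 t0 => fD z1; clearbody t; nra.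
Qed.

End StateMeet.

Section Density.
Variables (R : realType) (G : zmodType) (P : set G) (e : G).
Hypotheses (dimG : dimension_group P) (simpleG : simple_group P).
Hypothesis unit_e : order_unit P e.

Let ordG : ordered_group P. Proof. by have [] := dimG. Qed.

(** Two steps: below [e] there is an [f] with small [sigma1], and below [f] an element lopsided the
    other way, whose two values are then both small. *)
Lemma small_lopsided (sigma1 sigma2 : G -> R) (eps : R) :
  extremal_states P e sigma1 -> extremal_states P e sigma2 -> sigma1 <> sigma2 -> 0 < eps ->
  exists g, [/\ 0 < sigma2 g, sigma2 g < sigma1 g / 2 & sigma1 g < eps].
Proof.
move=> ext1 ext2 s12 eps0; have [Pe _] := unit_e.
have [[D1 s1 e1] _] := ext1; have [[D2 s2 e2] _] := ext2.
have e0 : e <> 0.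
  move=> e0; move: e1; rewrite e0; have [S <-] := morph_additive D1.
  by rewrite raddf0 => /esym/eqP; rewrite oner_eq0.
have [f [Pf Pef f0 lt]] :=
  lopsided_below dimG simpleG unit_e ext2 ext1 (nesym s12) Pe e0 eps0.
have [g [Pg Pfg g0 lt']] :=
  lopsided_below dimG simpleG unit_e ext1 ext2 s12 Pf f0 (divr_gt0 ltr01 (ltr0Sn R 1)).
exists g; split; last 1 first.
- have := s1 _ Pfg; have := s2 _ Pef; have [S1 E1] := morph_additive D1.
  have [S2 E2] := morph_additive D2; rewrite -E1 -E2 !raddfB /= E1 E2 e2; nra.
- by apply: (state_gt0 ordG simpleG (proj1 ext2) Pg g0).
- lra.
Qed.

(** Two small elements lopsided in opposite ways map to a basis of the plane; rounding down the
    coordinates of the target costs at most one basis vector in each direction. *)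
Lemma states_dense (sigma1 sigma2 : G -> R) (t1 t2 eps : R) :
  extremal_states P e sigma1 -> extremal_states P e sigma2 -> sigma1 <> sigma2 -> 0 < eps ->
  exists g, `|sigma1 g - t1| < eps /\ `|sigma2 g - t2| < eps.
Proof.
move=> ext1 ext2 s12 eps0.
have eps2 : 0 < eps / 2 by rewrite divr_gt0.
have [g [y1_gt0 y1_lt x1_lt]] := small_lopsided ext1 ext2 s12 eps2.
have [g' [x2_gt0 x2_lt y2_lt]] := small_lopsided ext2 ext1 (nesym s12) eps2.
move: y1_gt0 y1_lt x1_lt x2_gt0 x2_lt y2_lt.
have [[/morph_additive[S1 E1] _ _] _] := ext1; have [[/morph_additive[S2 E2] _ _] _] := ext2.
rewrite -E1 -E2; set x1 := S1 g; set y1 := S2 g; set x2 := S1 g'; set y2 := S2 g'.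
move=> y1_gt0 y1_lt x1_lt x2_gt0 x2_lt y2_lt.
pose D := x1 * y2 - x2 * y1; have D0 : D != 0 by rewrite gt_eqF// /D; nra.
pose a := (t1 * y2 - t2 * x2) / D; pose b := (t2 * x1 - t1 * y1) / D.
have aE : a * D = t1 * y2 - t2 * x2 by rewrite /a mulfVK.
have bE : b * D = t2 * x1 - t1 * y1 by rewrite /b mulfVK.
clearbody a b.
have t1E : a * x1 + b * x2 = t1 by apply: (mulIf D0); rewrite mulrDl !(mulrAC _ _ D) aE bE /D; lra.
have t2E : a * y1 + b * y2 = t2 by apply: (mulIf D0); rewrite mulrDl !(mulrAC _ _ D) aE bE /D; lra.
have [k ak] := floor_exists a; have [l bl] := floor_exists b.
exists (g *~ k + g' *~ l); rewrite (raddfD S1) (raddfD S2) !(raddfMz S1) !(raddfMz S2) /= -/x1 -/x2 -/y1 -/y2.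
rewrite -(mulrzr x1 k) -(mulrzr y1 k) -(mulrzr x2 l) -(mulrzr y2 l).
have frac (u : R) z w : 0 < w -> z <= u < z + 1 -> 0 <= u * w - z * w <= w.
  move=> w0 /andP[zu uz]; rewrite -mulrBl mulr_ge0 ?(ltW w0) ?subr_ge0//=.
  by rewrite -[leRHS]mul1r ler_wpM2r ?(ltW w0)//; lra.
have x1_gt0 : 0 < x1 by lra.
have y2_gt0 : 0 < y2 by lra.
have := frac a _ _ x1_gt0 ak; have := frac a _ _ y1_gt0 ak.
have := frac b _ _ x2_gt0 bl; have := frac b _ _ y2_gt0 bl.
move=> /andP[? ?] /andP[? ?] /andP[? ?] /andP[? ?].
by rewrite -t1E -t2E; split; rewrite ltr_norml; apply/andP; split; lra.
Qed.

End Density.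

(** * Generators with almost constant coefficients *)

(* The first generator corrects the multiplicity of [s]. *)
Definition correction p T (a : int) (k : 'I_p) (j : 'I_(2 + p)) : int :=
  match fintype.split j with
  | inl i => if i == 0 then a - T%:Z else 0
  | inr k' => (k' == k)%:Z
  end.

(** The quotient of [c] by [N] is spread evenly over all generators, whose sum is [N] times [s]; a
    bounded correction produces the remainder and [rho k]. *)
Definition coefficients p T (N : nat) (c : int) (k : 'I_p) (j : 'I_(2 + p)) : int :=
  (c %/ N)%Z + correction T (c %% N)%Z k j.

Lemma correction_bound p T (N a : int) (k : 'I_p) j : 0 <= a -> a < N ->
  - T%:Z <= correction T a k j <= N.
Proof.
move=> a0 aN; rewrite /correction.
case: (fintype.split j) => [i|k']; [case: (i == 0)|case: (k' == k)]; lia.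
Qed.

Section Generators.
Variable G : zmodType.

Section Defs.
Variables (p : nat) (s : G) (T : nat) (rho : 'I_p -> G).

(* [2 + p] elements, all but the first close to [T s], whose sum is the exact
   multiple [(1 + (p + 1) T) s] of [s]. *)
Definition generators (j : 'I_(2 + p)) : G :=
  match fintype.split j with
  | inl i => if i == 0 then s else s *+ T - \sum_k rho k
  | inr k => s *+ T + rho k
  end.

Lemma sum_generators (F : 'I_(2 + p) -> G) :
  \sum_j F j = F (lshift p 0) + F (lshift p 1) + \sum_k F (rshift 2 k).
Proof.
rewrite big_split_ord big_ord_recl big_ord1; congr (_ + F _ + _).
by apply: val_inj.
Qed.

Lemma generators_l i : generators (lshift p i) = if i == 0 then s else s *+ T - \sum_k rho k.
Proof. by rewrite /generators (unsplitK (inl _ _)). Qed.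

Lemma generators_r k : generators (rshift 2 k) = s *+ T + rho k.
Proof. by rewrite /generators (unsplitK (inr _ _)). Qed.

Lemma generators_sum : \sum_j generators j = s *+ (1 + p.+1 * T).
Proof.
rewrite sum_generators !generators_l (eq_bigr _ (fun k _ => generators_r k)) /=.
rewrite big_split /= sumr_const card_ord.
rewrite mulrnDr mulSn [s *+ (T + _)]mulrnDr mulnC mulrnA mulr1n.
by rewrite -!addrA; congr (_ + (_ + _)); rewrite addrCA addNr addr0.
Qed.

Lemma generators_correction a k :
  \sum_j generators j *~ correction T a k j = s *~ a + rho k.
Proof.
rewrite sum_generators !generators_l /correction !(unsplitK (inl _ _)) /= mulr0z addr0.
rewrite (bigD1 k)//= (unsplitK (inr _ _)) eqxx generators_r mulr1z big1 ?addr0; last first.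
  by move=> i ik; rewrite (unsplitK (inr _ _)) (negbTE ik) mulr0z.
by rewrite addrA mulrzBr -pmulrn subrK.
Qed.

End Defs.

Variables (p : nat) (h : 'I_p -> G) (s1 s2 : G) (T : nat) (C D : 'I_p -> int).
Let rho k := h k - (s1 *~ C k + s2 *~ D k).
Let N := (1 + p.+1 * T)%N.

Lemma generators_coefficients (s : G) (rho' : 'I_p -> G) c (k : 'I_p) :
  \sum_j generators s T rho' j *~ coefficients T N c k j = s *~ c + rho' k.
Proof.
have E j : generators s T rho' j *~ coefficients T N c k j =
    generators s T rho' j *~ (c %/ N)%Z + generators s T rho' j *~ correction T (c %% N)%Z k j.
  by rewrite -mulrzDr.
rewrite (eq_bigr _ (fun j _ => E j)) big_split /= -mulrz_suml generators_sum.
rewrite generators_correction pmulrn -mulrzA addrA -mulrzDr [N%:Z * _]mulrC.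
by rewrite -divz_eq.
Qed.

Lemma generators_decomposition k : h k =
  \sum_j generators s1 T rho j *~ coefficients T N (C k) k j +
  \sum_j generators s2 T (fun=> 0) j *~ coefficients T N (D k) k j.
Proof.
by rewrite !generators_coefficients addr0 addrAC /rho addrC subrK.
Qed.

End Generators.

(** The error is independent of [c], hence negligible once the coefficients are large. *)
Lemma coefficients_approx (R : realType) (p T N : nat) (c : int) (k : 'I_p) j (alpha : R) :
  (0 < N)%N -> c%:~R <= alpha < c%:~R + 1 ->
  `|(coefficients T N c k j)%:~R - alpha / N%:R| <= (N + T + 3)%:R.
Proof.
move=> N0 /andP[c_le c_lt]; have Nz : N%:Z != 0 by rewrite -lt0n.
have m0 : 0 <= (c %% N)%Z by rewrite modz_ge0.
have mN : (c %% N)%Z < N by rewrite ltz_mod.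
have /andP[lo hi] := correction_bound T k j m0 mN.
rewrite /coefficients; move: (correction _ _ _ _) lo hi => E lo hi.
have cE := divz_eq c N; move: (c %/ N)%Z (c %% N)%Z m0 mN cE => q m m0 mN cE.
have RN : 1 <= N%:R :> R by rewrite ler1n.
have : 0 <= alpha / N%:R - q%:~R <= 2.
  have -> : alpha / N%:R - q%:~R = (alpha - q%:~R * N%:R) / N%:R.
    by rewrite mulrBl mulfK// pnatr_eq0 -lt0n.
  have e : c%:~R = q%:~R * N%:R + m%:~R :> R by rewrite cE intrD intrM.
  have m0' : 0 <= m%:~R :> R by rewrite ler0z.
  have mN' : m%:~R <= N%:R :> R by rewrite -[N%:R]/(N%:Z%:~R) ler_int ltW.
  rewrite divr_ge0 ?ler0n//=; last lra.
  by rewrite ler_pdivrMr ?ltr0n//; lra.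
have lo' : - T%:R <= E%:~R :> R.
  by rewrite -[T%:R]/(T%:Z%:~R) -intrN ler_int.
have hi' : E%:~R <= N%:R :> R by rewrite -[N%:R]/(N%:Z%:~R) ler_int.
have T0 : 0 <= T%:R :> R := ler0n _ _.
move=> /andP[f0 f1]; rewrite intrD !natrD ler_norml; apply/andP; split; lra.
Qed.

Lemma near_ratio (R : realFieldType) (r z m x y : R) : 1 < r < 2 -> 0 < z -> 4 * z <= r - 1 -> 0 < m ->
  `|x - m| <= z * m -> `|y - m| <= z * m -> [/\ 0 < x, 0 < y & r^-1 * x < y < r * x].
Proof.
move=> /andP[r1 r2] z0 zr m0; rewrite !ler_norml => /andP[xl xu] /andP[yl yu].
have x0 : 0 < x by nra.
have y0 : 0 < y by nra.
(* Indeed [r >= 1 + 4 * z], and [(1 + 4 * z) * (1 - z)] exceeds [1 + z] by [2 * z * (1 - 2 * z)]. *)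
have key : (1 + z) * m < r * ((1 - z) * m).
  rewrite mulrA ltr_pM2r//.
  have : (1 + 4 * z) * (1 - z) <= r * (1 - z) by apply: ler_wpM2r; lra.
  have : 0 < z * (1 - 2 * z) by apply: mulr_gt0; lra.
  lra.
have up a : (1 - z) * m <= a -> r * ((1 - z) * m) <= r * a.
  by move=> ?; apply: ler_wpM2l => //; lra.
split=> //; apply/andP; split.
  rewrite mulrC ltr_pdivrMr 1?mulrC; last lra.
  by apply: le_lt_trans (lt_le_trans key (up _ _)); lra.
by apply: le_lt_trans (lt_le_trans key (up _ _)); lra.
Qed.

(** * Pairs of elements with prescribed directions *)

Section FineGenerators.
Variables (R : realType) (G : zmodType) (S1 S2 : {additive G -> R}).
Hypothesis dense : forall t1 t2 eps : R, 0 < eps ->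
  exists g, `|S1 g - t1| < eps /\ `|S2 g - t2| < eps.

Lemma basis_exists (l t s : R) : 2 <= l -> 0 < t -> t <= 1 / 8 -> 0 < s ->
  exists s1 s2 : G,
  [/\ `|S1 s1 - s| <= t * s, `|l * S2 s1 - s| <= t * s,
      `|S2 s2 - s| <= t * s & `|l * S1 s2 - s| <= t * s].
Proof.
move=> l2 t0 t1 s0; have l0 : 0 < l by lra.
have e0 : 0 < t * s / l by rewrite divr_gt0 ?mulr_gt0.
have small x : `|x - s| < t * s / l -> `|x - s| <= t * s.
  move=> /ltW/le_trans; apply; rewrite ler_pdivrMr// ler_peMr ?mulr_ge0 ?ltW//; lra.
have scale x : `|x - s / l| < t * s / l -> `|l * x - s| <= t * s.
  move=> /ltW; rewrite -(ler_pM2l l0) -{1}(gtr0_norm l0) -normrM mulrBr.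
  by rewrite !(mulrC l (_ / l)) !mulfVK// gt_eqF.
have [s1 [? ?]] := dense s (s / l) e0; have [s2 [? ?]] := dense (s / l) s e0.
by exists s1, s2; split; [apply: small|apply: scale|apply: small|apply: scale].
Qed.

(* The vector with coordinates [(x, y)] in a basis close to
   [s * (1, 1 / l), s * (1 / l, 1)] has a direction close to that of the first
   basis vector as soon as [y] is negligible compared with [x / l]. *)
Lemma direction_near (l z s t x1 y1 x2 y2 x y : R) :
  2 <= l -> 0 < z -> z <= 1 / 4 -> 0 < s -> t <= z / 2 ->
  `|x1 - s| <= t * s -> `|l * y1 - s| <= t * s ->
  `|y2 - s| <= t * s -> `|l * x2 - s| <= t * s ->
  0 < x -> 4 * l * `|y| <= z * x ->
  `|x * x1 + y * x2 - x * s| <= z * (x * s) /\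
  `|l * (x * y1 + y * y2) - x * s| <= z * (x * s).
Proof.
move=> l2 z0 z1 s0 tz h1 h2 h3 h4 x0 hy.
have ts : t * s <= z / 2 * s by rewrite ler_pM2r.
have zs : z * s <= s / 4 by rewrite mulrC ler_pM2l//; lra.
have xts : x * (t * s) <= z / 2 * (x * s) by rewrite mulrCA; nra.
have y0 := normr_ge0 y.
have y2s : `|y2| <= 2 * s by move: h3; rewrite ler_norml => /andP[? ?]; rewrite ler_norml; lra.
have x2s : `|l * x2| <= 2 * s by move: h4; rewrite ler_norml => /andP[? ?]; rewrite ler_norml; lra.
have ys : l * `|y| * (2 * s) <= z / 2 * (x * s).
  by have : 4 * l * `|y| * s <= z * x * s by [rewrite ler_pM2r]; lra.
split.
  have -> : x * x1 + y * x2 - x * s = x * (x1 - s) + y * x2 by lra.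
  apply: le_trans (ler_normD _ _) _; rewrite !normrM (gtr0_norm x0).
  have a1 : x * `|x1 - s| <= x * (t * s) by rewrite ler_pM2l.
  have a2 : `|y| * `|x2| <= l * `|y| * (2 * s).
    have x2s' : `|x2| <= 2 * s.
      apply: le_trans _ x2s; rewrite normrM ler_peMl// gtr0_norm; lra.
    apply: (@le_trans _ _ (`|y| * (2 * s))); first by rewrite ler_wpM2l.
    by apply: ler_wpM2r; [lra | rewrite ler_peMl//; lra].
  lra.
have -> : l * (x * y1 + y * y2) - x * s = x * (l * y1 - s) + l * y * y2 by lra.
have l0 : 0 < l by lra.
apply: le_trans (ler_normD _ _) _; rewrite !normrM (gtr0_norm x0) (gtr0_norm l0).
have a1 : x * `|l * y1 - s| <= x * (t * s) by rewrite ler_pM2l.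
have a2 : l * `|y| * `|y2| <= l * `|y| * (2 * s) by rewrite ler_wpM2l// mulr_ge0// ltW.
lra.
Qed.

End FineGenerators.

(** Positivity makes the pair a basis; the quadratic upper bound makes coordinates large when [s] is
    small. *)
Lemma determinant_bounds (R : realFieldType) (l t s x1 y1 x2 y2 : R) :
  2 <= l -> t <= 1 / 8 -> 0 < s ->
  `|x1 - s| <= t * s -> `|l * y1 - s| <= t * s ->
  `|y2 - s| <= t * s -> `|l * x2 - s| <= t * s ->
  0 < x1 * y2 - x2 * y1 <= 4 * (s * s).
Proof.
move=> l2 t8 s0; rewrite !ler_norml.
have ts : t * s <= s / 8 by rewrite mulrC ler_pM2l//; lra.
move=> /andP[? ?] /andP[? ?] /andP[? ?] /andP[? ?].
have l0 : 0 < l by lra.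
have y1_gt0 : 0 < y1 by rewrite -(pmulr_rgt0 _ l0); lra.
have x2_gt0 : 0 < x2 by rewrite -(pmulr_rgt0 _ l0); lra.
have : 2 * y1 <= l * y1 by rewrite ler_pM2r.
have : 2 * x2 <= l * x2 by rewrite ler_pM2r.
move=> ? ?; have p1 : 7 / 8 * s * (7 / 8 * s) <= x1 * y2 by apply: ler_pM; lra.
have p2 : x1 * y2 <= 9 / 8 * s * (9 / 8 * s) by apply: ler_pM; lra.
have p3 : x2 * y1 <= 9 / 16 * s * (9 / 16 * s) by apply: ler_pM; lra.
have p4 : 0 < x2 * y1 by apply: mulr_gt0.
have ss : 0 < s * s by rewrite mulr_gt0.
by apply/andP; split; lra.
Qed.

(** Provides the multiple [T] against which perturbations with coordinates up to [p] are
    negligible. *)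
Lemma multiple_exists (R : realType) (l z p : R) : 0 < l -> 0 < z -> 0 <= p ->
  exists T : nat, p < T%:R /\ 4 * l * p <= z * (T%:R - p).
Proof.
move=> l0 z0 p0; pose B := 4 * l * p / z + p.
have Bp : 0 <= B - p.
  rewrite /B addrK; apply: divr_ge0; last exact: ltW.
  by apply: mulr_ge0 => //; lra.
have B0 : 0 <= B by lra.
have /andP[_ lt] := truncn_itv B0.
exists (Num.truncn B).+1; split; first lra.
have : z * (B - p) <= z * ((Num.truncn B).+1%:R - p) by rewrite ler_pM2l// lerD2r ltW.
by rewrite /B addrK mulrC mulfVK// gt_eqF.
Qed.

Lemma sum_fractions (R : realFieldType) p (f : 'I_p -> R) :
  (forall i, 0 <= f i <= 1) -> 0 <= \sum_i f i <= p%:R.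
Proof.
move=> f01; rewrite sumr_ge0 /=; last by move=> i _; have /andP[] := f01 i.
rewrite -[leRHS](_ : \sum_(i < p) 1 = _); last by rewrite sumr_const card_ord.
by apply: ler_sum => i _; have /andP[] := f01 i.
Qed.

Section FineDecomposition.
Variables (R : realType) (G : zmodType) (S1 S2 : {additive G -> R}).
Hypothesis dense : forall t1 t2 eps : R, 0 < eps ->
  exists g, `|S1 g - t1| < eps /\ `|S2 g - t2| < eps.

(* The generators [g1 j] have directions close to [(1, 1 / l)], the [g2 j] have
   directions close to [(1 / l, 1)], and their sums are balanced. *)
Definition aligned (r l : R) J (g1 g2 : 'I_J -> G) (m : R) : Prop :=
  [/\ forall j, [/\ 0 < S1 (g1 j), 0 < S2 (g1 j) &
        r^-1 * S1 (g1 j) < l * S2 (g1 j) < r * S1 (g1 j)],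
      forall j, [/\ 0 < S1 (g2 j), 0 < S2 (g2 j) &
        r^-1 * S2 (g2 j) < l * S1 (g2 j) < r * S2 (g2 j)]
    & [/\ 0 < m, r^-1 * m < \sum_j S1 (g1 j) < r * m
        & r^-1 * m < \sum_j S2 (g2 j) < r * m]].

Lemma scaled_basis (l t Y n : R) : 2 <= l -> 0 < t -> t <= 1 / 8 -> 0 < Y -> 1 <= n ->
  exists s1 s2 s k Dt, [/\ 0 < s, 0 < Dt, Y <= k, k * (n * Dt) = s &
    [/\ Dt = S1 s1 * S2 s2 - S1 s2 * S2 s1,
      `|S1 s1 - s| <= t * s, `|l * S2 s1 - s| <= t * s,
      `|S2 s2 - s| <= t * s & `|l * S1 s2 - s| <= t * s]].
Proof.
(* Since [Dt <= 4 * (s * s)], the scale [k = s / (n * Dt)] is at least [1 / (4 * n * s)], which is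
   [Y]. *)
move=> l2 t0 t8 Y0 n1; pose s := (4 * n * Y)^-1.
have n0 : 0 < n by lra.
have nY : 0 < 4 * n * Y by apply: mulr_gt0 => //; lra.
have s0 : 0 < s by rewrite invr_gt0.
have sE : s * (4 * n * Y) = 1 by rewrite mulVf// gt_eqF.
have [s1 [s2 [h1 h2 h3 h4]]] := basis_exists dense l2 t0 t8 s0.
have /andP[Dt0 Dt4] := determinant_bounds l2 t8 s0 h1 h2 h3 h4.
have nDt0 := mulr_gt0 n0 Dt0.
exists s1, s2, s, (s / (n * (S1 s1 * S2 s2 - S1 s2 * S2 s1))),
  (S1 s1 * S2 s2 - S1 s2 * S2 s1).
split=> //; last by rewrite mulfVK// gt_eqF.
rewrite ler_pdivlMr//; move: Dt4; rewrite -(ler_pM2l n0) -(ler_pM2l Y0).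
have -> : Y * (n * (4 * (s * s))) = s * (4 * n * Y) * s by clear; lra.
by rewrite sE mul1r.
Qed.

Lemma coordinates_exist s1 s2 Dt g : Dt = S1 s1 * S2 s2 - S1 s2 * S2 s1 -> 0 < Dt ->
  exists ab : R * R, [/\ ab.1 * Dt = S1 g * S2 s2 - S2 g * S1 s2,
    ab.2 * Dt = S2 g * S1 s1 - S1 g * S2 s1,
    S1 g = ab.1 * S1 s1 + ab.2 * S1 s2 & S2 g = ab.1 * S2 s1 + ab.2 * S2 s2].
Proof.
move=> DtE Dt0; have Dtn := lt0r_neq0 Dt0.
have div v : exists u, u * Dt = v by exists (v / Dt); rewrite mulfVK.
have [u uE] := div (S1 g * S2 s2 - S2 g * S1 s2).
have [v vE] := div (S2 g * S1 s1 - S1 g * S2 s1).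
exists (u, v); split=> //=; apply: (mulIf Dtn);
  rewrite mulrDl !(mulrAC _ _ Dt) uE vE DtE; lra.
Qed.

(** Apart from [s1] itself, every generator has first coordinate at least [T - p] and second one at
    most [p] in absolute value: each [rho i] has fractional coordinates, and at most [p] of them are
    summed. *)
Lemma generators_coordinates p (s1 s2 : G) (T : nat) (rho : 'I_p -> G) (fa fb : 'I_p -> R) (l z : R) :
  (forall i, 0 <= fa i <= 1) -> (forall i, 0 <= fb i <= 1) ->
  (forall i, S1 (rho i) = fa i * S1 s1 + fb i * S1 s2) ->
  (forall i, S2 (rho i) = fa i * S2 s1 + fb i * S2 s2) ->
  0 < l -> 0 < z -> p%:R < T%:R :> R -> 4 * l * p%:R <= z * (T%:R - p%:R) ->
  forall j, exists x y, [/\ 0 < x, 4 * l * `|y| <= z * x,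
    S1 (generators s1 T rho j) = x * S1 s1 + y * S1 s2 &
    S2 (generators s1 T rho j) = x * S2 s1 + y * S2 s2].
Proof.
move=> fa01 fb01 S1rho S2rho l0 z0 pT TE j.
have coord (x y : R) : T%:R - p%:R <= x -> `|y| <= p%:R -> 0 < x /\ 4 * l * `|y| <= z * x.
  move=> Tx yp; split; first lra.
  apply: (@le_trans _ _ (4 * l * p%:R)); first by rewrite ler_pM2l ?mulr_gt0.
  by apply: le_trans TE _; rewrite ler_pM2l.
have S1sum : S1 (\sum_i rho i) = (\sum_i fa i) * S1 s1 + (\sum_i fb i) * S1 s2.
  by rewrite raddf_sum !mulr_suml -big_split; apply: eq_bigr => i _; exact: S1rho.
have S2sum : S2 (\sum_i rho i) = (\sum_i fa i) * S2 s1 + (\sum_i fb i) * S2 s2.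
  by rewrite raddf_sum !mulr_suml -big_split; apply: eq_bigr => i _; exact: S2rho.
case: (split_ordP j) => [i ->|i ->]; [rewrite generators_l|rewrite generators_r].
  case: (i == 0).
    by exists 1, 0; rewrite normr0 !mul1r !mul0r !addr0 mulr0 mulr1; split=> //; apply: ltW.
  have /andP[a0 ap] := sum_fractions fa01; have /andP[b0 bp] := sum_fractions fb01.
  have [x0 xy] : 0 < T%:R - \sum_i fa i /\
      4 * l * `|- \sum_i fb i| <= z * (T%:R - \sum_i fa i).
    by apply: coord; rewrite ?normrN ?ger0_norm// lerD2l lerN2.
  exists (T%:R - \sum_i fa i), (- \sum_i fb i).
  rewrite (raddfB S1) (raddfB S2) (raddfMn S1) (raddfMn S2) /= S1sum S2sum.
  rewrite -(mulr_natl (S1 s1)) -(mulr_natl (S2 s1)).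
  by rewrite !mulrBl !mulNr !opprD !addrA; split.
have /andP[a0 a1] := fa01 i; have /andP[b0 b1] := fb01 i.
have p1 : 1 <= p%:R :> R by rewrite ler1n (leq_ltn_trans (leq0n i) (ltn_ord i)).
have [x0 xy] : 0 < T%:R + fa i /\ 4 * l * `|fb i| <= z * (T%:R + fa i).
  by apply: coord; [lra | rewrite ger0_norm// (le_trans b1)].
exists (T%:R + fa i), (fb i).
rewrite (raddfD S1) (raddfD S2) (raddfMn S1) (raddfMn S2) /= S1rho S2rho.
by rewrite -(mulr_natl (S1 s1)) -(mulr_natl (S2 s1)) !(mulrDl T%:R) !addrA; split.
Qed.

(** Here [k] is the scale of the coefficients, and [a, d] near 1 and [b, c] near [1 / l] are the
    normalized entries of the basis, as they occur in Cramer's rule. The approximate values do not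
    depend on [j]. *)
Lemma fine_decomposition p (h : 'I_p -> G) (l r t Y : R) :
  2 <= l -> 1 < r < 2 -> 0 < t -> 0 < Y ->
  exists J (g1 g2 : 'I_J -> G) (D1 D2 : 'I_J -> 'I_p -> int) (m k a b c d : R),
  [/\ (0 < J)%N, Y <= k, aligned r l g1 g2 m &
      [/\ forall i, h i = \sum_j g1 j *~ D1 j i + \sum_j g2 j *~ D2 j i,
        [/\ `|a - 1| <= t, `|d - 1| <= t, `|l * b - 1| <= t & `|l * c - 1| <= t],
        forall j i, `|(D1 j i)%:~R - k * (a * S1 (h i) - b * S2 (h i))| <= t * k
      & forall j i, `|(D2 j i)%:~R - k * (d * S2 (h i) - c * S1 (h i))| <= t * k]].
Proof.
move=> l2 r12 t0 Y0; have l0 : 0 < l by lra.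
have [z [z0 z1 zr]] : exists z, [/\ 0 < z, z <= 1 / 4 & 4 * z <= r - 1].
  by have /andP[? ?] := r12; exists ((r - 1) / 4); split; lra.
have [t' [t'0 t't t'z t'8]] : exists t', [/\ 0 < t', t' <= t, t' <= z / 2 & t' <= 1 / 8].
  exists (Num.min t (z / 2)); rewrite lt_min t0 divr_gt0// !ge_min !lexx orbT; split=> //.
  by apply/orP; right; lra.
have [T [pT TE]] := multiple_exists l0 z0 (ler0n R p).
have [N NE] : exists N, N = (1 + p.+1 * T)%N by eexists.
have N1 : 1 <= N%:R :> R by rewrite ler1n NE.
have N0 : 0 < N%:R :> R by rewrite (lt_le_trans _ N1).
have [Q QE] : exists Q : R, Q = (N + T + 3)%:R by eexists.
have Q0 : 0 < Q by rewrite QE ltr0n addn3.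
have [s1 [s2 [s [k [Dt [s0 Dt0 kY' kE [DtE h1 h2 h3 h4]]]]]]] :=
  (* Raising the required scale by [Q / t'] absorbs the rounding error [Q] into [t * k]. *)
  scaled_basis l2 t'0 t'8 (addr_gt0 Y0 (divr_gt0 Q0 t'0)) N1.
have Qt'0 := divr_gt0 Q0 t'0.
have kY : Y <= k by apply: le_trans kY'; rewrite lerDl ltW.
have k0 := lt_le_trans Y0 kY.
have Qk : Q <= t * k.
  have : Q / t' <= k by apply: le_trans kY'; rewrite lerDr ltW.
  by rewrite ler_pdivrMr// mulrC => /le_trans; apply; rewrite ler_pM2r.
have [ab abE] := choice (fun i => coordinates_exist (h i) DtE Dt0).
have [C CE] := choice (fun i => floor_exists (ab i).1).
have [D DE] := choice (fun i => floor_exists (ab i).2).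
pose rho i := h i - (s1 *~ C i + s2 *~ D i).
have fa01 i : 0 <= (ab i).1 - (C i)%:~R <= 1.
  by have /andP[? /ltW] := CE i; rewrite subr_ge0 lerBlDl => ->; rewrite andbT.
have fb01 i : 0 <= (ab i).2 - (D i)%:~R <= 1.
  by have /andP[? /ltW] := DE i; rewrite subr_ge0 lerBlDl => ->; rewrite andbT.
have S1rho i : S1 (rho i) = ((ab i).1 - (C i)%:~R) * S1 s1 + ((ab i).2 - (D i)%:~R) * S1 s2.
  have [_ _ e _] := abE i; rewrite (raddfB S1) (raddfD S1) !(raddfMz S1) /= e.
  by rewrite -(mulrzl (S1 s1)) -(mulrzl (S1 s2)) !mulrBl opprD addrACA.
have S2rho i : S2 (rho i) = ((ab i).1 - (C i)%:~R) * S2 s1 + ((ab i).2 - (D i)%:~R) * S2 s2.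
  have [_ _ _ e] := abE i; rewrite (raddfB S2) (raddfD S2) !(raddfMz S2) /= e.
  by rewrite -(mulrzl (S2 s1)) -(mulrzl (S2 s2)) !mulrBl opprD addrACA.
have coord1 := generators_coordinates fa01 fb01 S1rho S2rho l0 z0 pT TE.
(* The remainders are all carried by the first family; the second one consists of exact multiples of
   [s2]. *)
have coord2 (j : 'I_(2 + p)) : exists x, [/\ 0 < x,
    S1 (generators s2 T (fun=> 0) j) = x * S1 s2 &
    S2 (generators s2 T (fun=> 0) j) = x * S2 s2].
  have T0 : 0 < T%:R :> R by apply: le_lt_trans pT.
  have [S1T S2T] : S1 (s2 *+ T) = T%:R * S1 s2 /\ S2 (s2 *+ T) = T%:R * S2 s2.
    by rewrite (raddfMn S1) (raddfMn S2) /= !mulr_natl.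
  case: (split_ordP j) => [i ->|i ->]; [rewrite generators_l|rewrite generators_r addr0].
    case: (i == 0); first by exists 1; rewrite !mul1r.
    by exists T%:R; rewrite big1// subr0.
  by exists T%:R.
have ms0 : 0 < N%:R * s by rewrite mulr_gt0.
have balanced (v : R) : `|v - s| <= t' * s ->
    r^-1 * (N%:R * s) < v *+ N < r * (N%:R * s).
  move=> vs; have [||_ _ //] := near_ratio r12 z0 zr ms0 (x := N%:R * s) (y := v *+ N).
    by rewrite subrr normr0 mulr_ge0 ?ltW.
  rewrite -(mulr_natl v) -mulrBr normrM ger0_norm ?ler0n// mulrCA ler_pM2l//.
  by apply: le_trans vs _; rewrite ler_pM2r// (le_trans t'z)// ler_pdivrMr// ler_pMr// ler1n.
exists (2 + p)%N, (generators s1 T rho), (generators s2 T (fun=> 0)).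
exists (fun j i => coefficients T N (C i) i j), (fun j i => coefficients T N (D i) i j).
exists (N%:R * s), k, (S2 s2 / s), (S1 s2 / s), (S2 s1 / s), (S1 s1 / s).
have aligned_gen : aligned r l (generators s1 T rho) (generators s2 T (fun=> 0)) (N%:R * s).
  split=> [j|j|].
  - have [x [y [x0 xy -> ->]]] := coord1 j.
    have [n1 n2] := direction_near l2 z0 z1 s0 t'z h1 h2 h3 h4 x0 xy.
    have [? ly ?] := near_ratio r12 z0 zr (mulr_gt0 x0 s0) n1 n2.
    by split=> //; rewrite -(pmulr_rgt0 _ l0).
  - have [x [x0 -> ->]] := coord2 j.
    have y0 : 4 * l * `|0 : R| <= z * x by rewrite normr0 mulr0 mulr_ge0 ?ltW.
    have [] := direction_near l2 z0 z1 s0 t'z h3 h4 h1 h2 x0 y0.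
    rewrite !mul0r !addr0 => n1 n2.
    have [? ly ?] := near_ratio r12 z0 zr (mulr_gt0 x0 s0) n1 n2.
    by split=> //; rewrite -(pmulr_rgt0 _ l0).
  - by split=> //; rewrite -raddf_sum generators_sum -NE raddfMn; exact: balanced.
have ratio (v : R) : `|v - s| <= t' * s -> `|v / s - 1| <= t.
  move=> vs; rewrite -[X in _ - X](mulfV (lt0r_neq0 s0)) -mulrBl normrM.
  rewrite [`|s^-1|]gtr0_norm ?invr_gt0// ler_pdivrMr//.
  by apply: le_trans vs _; rewrite ler_pM2r.
have NDt0 := mulr_gt0 N0 Dt0.
have approx (c : int) i j (u v w a b : R) : c%:~R <= u < c%:~R + 1 ->
    u * Dt = v * a - w * b ->
    `|(coefficients T N c i j)%:~R - k * (a / s * v - b / s * w)| <= t * k.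
  move=> cu uE; apply: le_trans Qk; rewrite QE.
  (* By Cramer's rule and the choice of [k], the target is the coordinate [u] shared among [N]
     copies. *)
  have -> : k * (a / s * v - b / s * w) = u / N%:R; last first.
    by apply: coefficients_approx => //; rewrite NE.
  apply: (mulIf (lt0r_neq0 NDt0)).
  rewrite [RHS]mulrA mulfVK ?gt_eqF// uE mulrAC kE.
  have sK x y : s * (x / s * y) = y * x.
    by rewrite mulrA [s * _]mulrC divfK ?gt_eqF// mulrC.
  by rewrite mulrBr !sK.
split=> //; split.
- by rewrite NE; exact: generators_decomposition.
- by split; rewrite ?mulrA; apply: ratio.
- by move=> j i; have [e _ _ _] := abE i; apply: approx (CE i) e.
- by move=> j i; have [_ e _ _] := abE i; apply: approx (DE i) e.
Qed.

End FineDecomposition.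

(** * Refining a finite family *)

Section RefineFamily.
Variables (R : realType) (G : zmodType) (P : set G) (S1 S2 : {additive G -> R}).
Hypothesis dimG : dimension_group P.
Hypothesis dense : forall t1 t2 eps : R, 0 < eps ->
  exists g, `|S1 g - t1| < eps /\ `|S2 g - t2| < eps.

Lemma norm_le_sum n (F : 'I_n -> R) c : `|F c| <= \sum_i `|F i|.
Proof. by rewrite (bigD1 c)//= lerDl sumr_ge0. Qed.

Lemma weighted_approx p (D B : 'I_p -> int) (v : 'I_p -> R) (q : R) :
  (forall i, `|(D i)%:~R - v i| <= q) ->
  `|(\sum_i D i * B i)%:~R - \sum_i v i * (B i)%:~R| <= q * \sum_i `|(B i)%:~R|.
Proof.
move=> Dv; rewrite raddf_sum -sumrB mulr_sumr /=.
apply: le_trans (ler_norm_sum _ _ _) _; apply: ler_sum => i _.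
by rewrite intrM -mulrBl normrM ler_wpM2r.
Qed.

Lemma additive_family (S : {additive G -> R}) p (h : 'I_p -> G) (B : 'I_p -> int) :
  S (\sum_i h i *~ B i) = \sum_i S (h i) * (B i)%:~R.
Proof. by rewrite raddf_sum; apply: eq_bigr => i _; rewrite raddfMz mulrzr. Qed.

(** Replacing [a] by 1 costs [t * Sb]; dropping [b * v] costs [2 * Sb / l], at most [w / 2] for
    large [l]. *)
Lemma perturbed_approx (l t W Sb w k x a b u v : R) :
  0 < l -> 0 < t -> t <= 1 -> 0 < k -> 0 <= W -> 4 * Sb <= w * l -> t * (W + Sb) <= w / 2 ->
  `|x - k * (a * u - b * v)| <= t * k * W -> `|a - 1| <= t -> `|l * b - 1| <= t ->
  `|u| <= Sb -> `|v| <= Sb -> `|x - k * u| <= w * k.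
Proof.
move=> l0 t0 t1 k0 W0 Sbl tw xk a1 b1 uS vS.
have Sb0 : 0 <= Sb by apply: le_trans uS.
have bl : `|b| * l <= 2.
  have := le_trans (ler_normD (l * b - 1) 1) (lerD b1 (lexx _)).
  by rewrite subrK normr1 normrM gtr0_norm//; lra.
have bv : `|b * v| <= w / 2.
  rewrite normrM -(ler_pM2r l0) mulrAC.
  by apply: le_trans (ler_pM _ _ bl vS) _; [rewrite mulr_ge0// ltW | | lra].
have au : `|(a - 1) * u| <= t * Sb by rewrite normrM ler_pM.
have -> : x - k * u = (x - k * (a * u - b * v)) + k * ((a - 1) * u - b * v) by clear; lra.
apply: le_trans (ler_normD _ _) _; rewrite [`|k * _|]normrM gtr0_norm//.
have kk : k * `|(a - 1) * u - b * v| <= k * (t * Sb + w / 2).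
  rewrite ler_pM2l//; apply: le_trans (ler_normB _ _) _; exact: lerD.
have : k * (t * (W + Sb)) <= k * (w / 2) by rewrite ler_pM2l.
lra.
Qed.

Lemma coefficient_near (l t W z k x e : R) : 1 <= l -> 0 < k -> 0 <= t * k * W ->
  t * (1 + W * l) <= z -> `|x - k * e| <= t * k * W -> `|e - 1| <= t -> `|x - k| <= z * k.
Proof.
move=> l1 k0 tkW0 tz xe e1; rewrite -(ler_pM2r k0) in tz; apply: le_trans tz.
have -> : x - k = x - k * e + k * (e - 1) by rewrite mulrBr mulr1 addrA subrK.
apply: le_trans (ler_normD _ _) _; rewrite [`|k * _|]normrM (gtr0_norm k0).
have : k * `|e - 1| <= k * t by rewrite ler_pM2l.
have : t * k * W * 1 <= t * k * W * l by rewrite ler_wpM2l.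
lra.
Qed.

(** Concerns an element on which the leading state vanishes: only the small negative cross term
    remains, and multiplying by [l] brings it to size [k] but also enlarges the error. *)
Lemma cross_coefficient_near (l t W z k x e : R) : 0 < l -> 0 < k ->
  t * (1 + W * l) <= z -> `|x - k * (- e)| <= t * k * W -> `|l * e - 1| <= t ->
  `|- (l * x) - k| <= z * k.
Proof.
move=> l0 k0 tz xe e1; rewrite -(ler_pM2r k0) in tz; apply: le_trans tz.
have -> : - (l * x) - k = - (l * (x - k * (- e))) + k * (l * e - 1) by lra.
apply: le_trans (ler_normD _ _) _; rewrite normrN !normrM (gtr0_norm k0) (gtr0_norm l0).
have : k * `|l * e - 1| <= k * t by rewrite ler_pM2l.
have : l * `|x - k * (- e)| <= l * (t * k * W) by rewrite ler_pM2l.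
lra.
Qed.

Lemma truncn_near (k z : R) : 0 <= k -> 1 <= z * k -> `|(Num.truncn k)%:R - k| <= z * k.
Proof.
move=> /truncn_itv/andP[Kk]; rewrite -natr1 => kK zk.
by rewrite ler_norml; apply/andP; split; lra.
Qed.

(** The order of choices matters: the factorization [B] and the bounds [W], [Sb] come from [f], then
    [l] is taken large, then [t] small in terms of [l], and last the scale [k] large. Multiplying by
    [B] enlarges errors by at most [W] and kills the relations of [f]. *)
Lemma refine_family n (f : 'I_n -> G) i1 i2 (r w : R) (X : nat) :
  S1 (f i1) = 1 -> S2 (f i1) = 0 -> S1 (f i2) = 0 -> S2 (f i2) = 1 ->
  1 < r < 2 -> 0 < w ->
  exists J (g : 'I_(J + J) -> G) (A : 'M[int]_(J + J, n)) (l K : nat) (m k : R),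
  [/\ [/\ (0 < J)%N, (X <= l)%N, (X <= K)%N, X%:R <= k & 0 < k],
      aligned S1 S2 r l%:R (fun j => g (lshift J j)) (fun j => g (rshift J j)) m,
      (forall c, combine g (A *m c) = combine f c) /\
      (forall c, combine f c = 0 -> A *m c = 0),
      forall j i, `|(A (lshift J j) i)%:~R - k * S1 (f i)| <= w * k /\
                  `|(A (rshift J j) i)%:~R - k * S2 (f i)| <= w * k
    & forall j, [/\ r^-1 * K%:R < (A (lshift J j) i1)%:~R < r * K%:R,
                    r^-1 * K%:R < (A (rshift J j) i2)%:~R < r * K%:R,
                    r^-1 * K%:R < - (l%:R * (A (rshift J j) i1)%:~R) < r * K%:R
                  & r^-1 * K%:R < - (l%:R * (A (lshift J j) i2)%:~R) < r * K%:R]].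
Proof.
move=> S11 S21 S12 S22 r12 w0.
have [p [h [B [fE kerB]]]] := dim_factor dimG f.
pose W := \sum_c \sum_i `|(B i c)%:~R : R|.
have W0 : 0 <= W by do 2!apply: sumr_ge0 => ? _.
have WB c : \sum_i `|(B i c)%:~R : R| <= W.
  by rewrite [leRHS](bigD1 c)//= lerDl; do 2!apply: sumr_ge0 => ? _.
pose Sb := \sum_c `|S1 (f c)| + \sum_c `|S2 (f c)|.
have Sb0 : 0 <= Sb by rewrite addr_ge0 ?sumr_ge0.
have S1b c : `|S1 (f c)| <= Sb.
  by apply: le_trans (norm_le_sum (fun c => S1 (f c)) c) _; rewrite lerDl sumr_ge0.
have S2b c : `|S2 (f c)| <= Sb.
  by apply: le_trans (norm_le_sum (fun c => S2 (f c)) c) _; rewrite lerDr sumr_ge0.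
clearbody W Sb.
have [z [z0 zr]] : exists z, 0 < z /\ 4 * z <= r - 1.
  by have /andP[? ?] := r12; exists ((r - 1) / 4); split; lra.
have [l [Xl l2 Sbl]] : exists l : nat, [/\ (X <= l)%N, 2 <= l%:R :> R & 4 * Sb <= w * l%:R].
  have Sbw : 0 <= 4 * Sb / w by apply: divr_ge0; [lra | exact: ltW].
  have /andP[_ lt] := truncn_itv Sbw.
  exists ((Num.truncn (4 * Sb / w)).+1 + X + 2)%N.
  split; first by rewrite -addnA addnCA leq_addr.
    by rewrite ler_nat leq_addl.
  rewrite [w * _]mulrC -ler_pdivrMr//; apply: le_trans (ltW lt) _.
  by rewrite ler_nat -addnA leq_addr.
have l0 : 0 < l%:R :> R by lra.
have l1 : 1 <= l%:R :> R by lra.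
have [t [t0 t1 tw tz]] : exists t, [/\ 0 < t, t <= 1, t * (W + Sb) <= w / 2 &
    t * (1 + W * l%:R) <= z].
  have Wl : 0 <= W * l%:R := mulr_ge0 W0 (ltW l0).
  pose q := Num.min (Num.min (w / 2) z) 1.
  have q0 : 0 < q by rewrite !lt_min z0 ltr01 divr_gt0.
  have [qw qz q1] : [/\ q <= w / 2, q <= z & q <= 1].
    by rewrite /q !ge_min !lexx !orbT.
  have den : 0 < 1 + W * l%:R + W + Sb by lra.
  exists (q / (1 + W * l%:R + W + Sb)); split.
  - exact: divr_gt0.
  - by rewrite ler_pdivrMr// mul1r; lra.
  - rewrite mulrAC ler_pdivrMr//; by apply: ler_pM; try exact: ltW; lra.
  - rewrite mulrAC ler_pdivrMr//; by apply: ler_pM; try exact: ltW; lra.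
have zV : 0 < z^-1 by rewrite invr_gt0.
have X0 : 0 <= X%:R :> R := ler0n _ _.
(* The term [z^-1] ensures [1 <= z * k], so that truncating [k] to [K] is harmless. *)
have Y0 : 0 < X%:R + 1 + z^-1 by lra.
have [J [g1 [g2 [D1 [D2 [m [k [a [b [c [d [J0 kY al [hE [ha hd hb hc] HD1 HD2]]]]]]]]]]]]] :=
  fine_decomposition dense h l2 r12 t0 Y0.
have k0 : 0 < k by apply: lt_le_trans kY.
have tk0 : 0 < t * k by rewrite mulr_gt0.
have tkW0 : 0 <= t * k * W := mulr_ge0 (ltW tk0) W0.
have zk : 1 <= z * k.
  by rewrite mulrC -ler_pdivrMr// div1r; lra.
pose A1 : 'M[int]_(J, n) := \matrix_(j, i) \sum_q D1 j q * B q i.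
pose A2 : 'M[int]_(J, n) := \matrix_(j, i) \sum_q D2 j q * B q i.
pose g (j : 'I_(J + J)) := match fintype.split j with inl j' => g1 j' | inr j' => g2 j' end.
have gl j : g (lshift J j) = g1 j by rewrite /g (unsplitK (inl _ _)).
have gr j : g (rshift J j) = g2 j by rewrite /g (unsplitK (inr _ _)).
have AE : col_mx A1 A2 = col_mx (\matrix_(j, q) D1 j q) (\matrix_(j, q) D2 j q) *m B.
  rewrite mul_col_mx; congr col_mx; apply/matrixP => j i; rewrite !mxE;
  by apply: eq_bigr => q _; rewrite mxE.
have A1E j i : `|(A1 j i)%:~R - k * (a * S1 (f i) - b * S2 (f i))| <= t * k * W.
  have -> : k * (a * S1 (f i) - b * S2 (f i)) =
      \sum_q k * (a * S1 (h q) - b * S2 (h q)) * (B q i)%:~R.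
    rewrite fE !additive_family !mulr_sumr -sumrB mulr_sumr.
    by apply: eq_bigr => q _; clear; lra.
  rewrite mxE; apply: le_trans (weighted_approx (fun q => B q i) (HD1 j)) _.
  by rewrite ler_wpM2l// ltW.
have A2E j i : `|(A2 j i)%:~R - k * (d * S2 (f i) - c * S1 (f i))| <= t * k * W.
  have -> : k * (d * S2 (f i) - c * S1 (f i)) =
      \sum_q k * (d * S2 (h q) - c * S1 (h q)) * (B q i)%:~R.
    rewrite fE !additive_family !mulr_sumr -sumrB mulr_sumr.
    by apply: eq_bigr => q _; clear; lra.
  rewrite mxE; apply: le_trans (weighted_approx (fun q => B q i) (HD2 j)) _.
  by rewrite ler_wpM2l// ltW.
have /andP[Kk kK] := truncn_itv (ltW k0).
pose K := Num.truncn k.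
exists J, g, (col_mx A1 A2), l, K, m, k.
have Xk : X%:R <= k by apply: le_trans kY; rewrite -addrA lerDl addr_ge0// ltW.
have XK : (X <= K)%N.
  by rewrite -ltnS -(ltr_nat R); apply: le_lt_trans kK.
have Kz := truncn_near (ltW k0) zk.
have near x : `|x - k| <= z * k -> r^-1 * K%:R < x < r * K%:R.
  by move=> xk; have [_ _] := near_ratio r12 z0 zr k0 Kz xk.
have main x e (xe : `|x - k * e| <= t * k * W) (e1 : `|e - 1| <= t) :=
  near _ (coefficient_near l1 k0 tkW0 tz xe e1).
have cross x e (xe : `|x - k * (- e)| <= t * k * W) (e1 : `|l%:R * e - 1| <= t) :=
  near _ (cross_coefficient_near l0 k0 tz xe e1).
split=> //.
- have -> : (fun j => g (lshift J j)) = g1 by apply/funext.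
  by have -> : (fun j => g (rshift J j)) = g2 by apply/funext.
- split=> v; last first.
    by move=> /kerB v0; rewrite AE -mulmxA v0 mulmx0.
  apply: combine_mulmx => i; rewrite big_split_ord /=.
  have -> : f i = \sum_q (\sum_j g1 j *~ D1 j q *~ B q i + \sum_j g2 j *~ D2 j q *~ B q i).
    by rewrite fE; apply: eq_bigr => q _; rewrite -!mulrz_suml -mulrzDl -hE.
  rewrite big_split /=; congr (_ + _); rewrite exchange_big; apply: eq_bigr => j _.
    rewrite gl col_mxEu mxE mulrz_sumr; apply: eq_bigr => q _; by rewrite mulrzA.
  rewrite gr col_mxEd mxE mulrz_sumr; apply: eq_bigr => q _; by rewrite mulrzA.
- move=> j i; rewrite col_mxEu col_mxEd; split.
    exact: perturbed_approx l0 t0 t1 k0 W0 Sbl tw (A1E j i) ha hb (S1b i) (S2b i).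
  exact: perturbed_approx l0 t0 t1 k0 W0 Sbl tw (A2E j i) hd hc (S2b i) (S1b i).
- move=> j; rewrite !col_mxEu !col_mxEd; split.
  + by have := A1E j i1; rewrite S11 S21 mulr1 mulr0 subr0 => /main; apply.
  + by have := A2E j i2; rewrite S12 S22 mulr1 mulr0 subr0 => /main; apply.
  + by have := A2E j i1; rewrite S11 S21 mulr1 mulr0 sub0r => /cross; apply.
  + by have := A1E j i2; rewrite S12 S22 mulr1 mulr0 sub0r => /cross; apply.
Qed.

End RefineFamily.

(** * Construction of the sequence *)

Section Levels.
Variables (R : realType) (G : zmodType) (P : set G) (S1 S2 : {additive G -> R}).
Variables u1 u2 : G.
Hypothesis dimG : dimension_group P.
Hypothesis dense : forall t1 t2 eps : R, 0 < eps ->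
  exists g, `|S1 g - t1| < eps /\ `|S2 g - t2| < eps.
Hypotheses (S11 : S1 u1 = 1) (S21 : S2 u1 = 0) (S12 : S1 u2 = 0) (S22 : S2 u2 = 1).

(** [coords1] and [coords2] represent [u1] and [u2]; [lev_M] belongs to the matrix that enters the
    level, whereas [lev_l] and [lev_K] belong to its own generators and coordinates. *)
Record level := Level {
  width : nat;
  gens : 'I_(width + width) -> G;
  coords1 : 'cV[int]_(width + width);
  coords2 : 'cV[int]_(width + width);
  lev_K : nat; lev_l : nat; lev_M : nat }.

Arguments gens : clear implicits.

Definition gens1 L j := gens L (lshift (width L) j).
Definition gens2 L j := gens L (rshift (width L) j).
Arguments gens1 : clear implicits.
Arguments gens2 : clear implicits.

(** The inequalities in [aligned] are strict, which leaves room for the errors of the next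
    refinement. *)
Definition good_level (r : R) (L : level) : Prop :=
  [/\ [/\ (0 < width L)%N, (4 <= lev_K L)%N & (4 <= lev_l L)%N],
      exists m, aligned S1 S2 r (lev_l L)%:R (gens1 L) (gens2 L) m,
      combine (gens L) (coords1 L) = u1, combine (gens L) (coords2 L) = u2
    & let K : R := (lev_K L)%:R in let l : R := (lev_l L)%:R in forall j,
        [/\ r^-1 * K < (coords1 L (lshift _ j) 0)%:~R < r * K,
            r^-1 * K < (coords2 L (rshift _ j) 0)%:~R < r * K,
            r^-1 * K < - (l * (coords1 L (rshift _ j) 0)%:~R) < r * K
          & r^-1 * K < - (l * (coords2 L (lshift _ j) 0)%:~R) < r * K]].

Definition bounded_entries (r : R) (a l M J J' : nat) (A : 'M[int]_(J' + J', J + J)) : Prop :=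
  [/\ forall j' j, [/\ 0 < A (lshift J' j') (lshift J j), 0 < A (rshift J' j') (rshift J j),
        a%:Z <= A (lshift J' j') (rshift J j) & a%:Z <= A (rshift J' j') (lshift J j)],
      forall j' j'' j,
        r^-1 * (A (lshift J' j') (lshift J j))%:~R <= l%:R * (A (rshift J' j'') (lshift J j))%:~R
          <= r * (A (lshift J' j') (lshift J j))%:~R,
      forall j' j'' j,
        r^-1 * (A (rshift J' j') (rshift J j))%:~R <= l%:R * (A (lshift J' j'') (rshift J j))%:~R
          <= r * (A (rshift J' j') (rshift J j))%:~R,
      forall j', r^-1 * M%:R <= (\sum_j A (lshift J' j') (lshift J j))%:~R <= r * M%:R
    & forall j', r^-1 * M%:R <= (\sum_j A (rshift J' j') (rshift J j))%:~R <= r * M%:R].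

(** Relations die in one step and [x] becomes a nonnegative combination: these give the two
    conditions of [limit_criterion]. *)
Definition next_level (r : R) (a : nat) (x : G) (L L' : level)
    (A : 'M[int]_(width L' + width L', width L + width L)) : Prop :=
  [/\ [/\ (lev_K L < lev_K L')%N, (lev_l L < lev_l L')%N & (lev_M L < lev_M L')%N],
      (forall v, combine (gens L') (A *m v) = combine (gens L) v) /\
      (forall v, combine (gens L) v = 0 -> A *m v = 0),
      A *m coords1 L = coords1 L' /\ A *m coords2 L = coords2 L',
      exists v, simplicial_cone v /\ combine (gens L') v = x
    & bounded_entries r a (lev_l L) (lev_M L') A].

(** [M] stays free because a refinement chooses it afterwards, from [k]. *)
Lemma levels_of_family n (f : 'I_n -> G) i1 i2 (r w : R) (X : nat) :
  f i1 = u1 -> f i2 = u2 -> 1 < r < 2 -> 0 < w ->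
  exists J (g : 'I_(J + J) -> G) (A : 'M[int]_(J + J, n)) (l K : nat) (k : R),
  [/\ forall M, good_level r (Level g (col i1 A) (col i2 A) K l M),
      [/\ (X <= K)%N, (X <= l)%N, X%:R <= k & 0 < k],
      (forall v, combine g (A *m v) = combine f v) /\
      (forall v, combine f v = 0 -> A *m v = 0)
    & forall j i, `|(A (lshift J j) i)%:~R - k * S1 (f i)| <= w * k /\
                  `|(A (rshift J j) i)%:~R - k * S2 (f i)| <= w * k].
Proof.
move=> f1 f2 r12 w0.
have [||||J [g [A [l [K [m [k [[J0 Xl XK Xk k0] al [gA kerA] approx range]]]]]]]] :=
  refine_family dimG dense (f := f) (i1 := i1) (i2 := i2) (X + 4)%N _ _ _ _ r12 w0;
  rewrite ?f1 ?f2//.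
exists J, g, A, l, K, k; split=> //.
  have colE i : combine g (col i A) = f i by rewrite colE gA combine_delta.
  move=> M; split=> //=.
  - by split=> //; [apply: leq_trans XK | apply: leq_trans Xl]; rewrite leq_addl.
  - by exists m.
  - by rewrite colE.
  - by rewrite colE.
  - by move=> j; rewrite !mxE; apply: range.
split=> //; [apply: leq_trans XK| apply: leq_trans Xl| apply: le_trans Xk]; rewrite ?leq_addr//.
by rewrite ler_nat leq_addr.
Qed.

(** Starting at 3, strict growth makes every later multiplicity at least 4. *)
Lemma initial_level (r : R) : 1 < r < 2 -> exists L, good_level r L /\ lev_M L = 3%N.
Proof.
move=> r12; pose f (i : 'I_2) := if i == 0 then u1 else u2.
have [J [g [A [l [K [k [good _ _ _]]]]]]] :=
  @levels_of_family 2 f 0 1 r 1 0 erefl erefl r12 ltr01.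
by eexists; split; [exact: (good 3%N)|].
Qed.

(** Stated with a filter so that finitely many conditions on the tolerance [w] can be met at
    once. *)
Lemma near_slack (c C : R) : 0 < c -> 0 <= C -> \forall w \near 0^'+, w * C <= c.
Proof.
move=> c0 C0; have C1 : 0 < C + 1 by lra.
near=> w; have w0 : 0 < w by near: w; exact: nbhs_right_gt.
have : w <= c / (C + 1) by near: w; apply: nbhs_right_le; exact: divr_gt0.
by rewrite ler_pdivlMr// mulrDr; lra.
Unshelve. all: by end_near. Qed.

Lemma ratio_perturbed (r l k w x y a b : R) : 1 < r -> 0 < l -> 0 < k ->
  w * (r + l + 1) <= r * x - l * y -> w * (r + l + 1) <= l * y - r^-1 * x -> 0 < w ->
  `|a - k * x| <= w * k -> `|b - k * y| <= w * k -> r^-1 * a <= l * b <= r * a.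
Proof.
move=> r1 l0 k0 h1 h2 w0; rewrite !ler_norml => /andP[? ?] /andP[? ?].
have r0 : 0 < r by lra.
have ri0 : 0 < r^-1 by rewrite invr_gt0.
have ri1 : r^-1 <= 1 by rewrite invf_le1//; lra.
have h1' : k * (w * (r + l + 1)) <= k * (r * x - l * y) by rewrite ler_pM2l.
have h2' : k * (w * (r + l + 1)) <= k * (l * y - r^-1 * x) by rewrite ler_pM2l.
have wk0 : 0 < w * k by rewrite mulr_gt0.
have la : l * b <= l * (k * y + w * k) by rewrite ler_pM2l//; lra.
have lb : l * (k * y - w * k) <= l * b by rewrite ler_pM2l//; lra.
have ra : r * (k * x - w * k) <= r * a by rewrite ler_pM2l//; lra.
have rb : r^-1 * a <= r^-1 * (k * x + w * k) by rewrite ler_pM2l//; lra.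
have rc : r^-1 * (w * k) <= w * k by rewrite ler_piMl// ltW.
have rw : 0 < r * (w * k) by rewrite mulr_gt0.
by apply/andP; split; lra.
Qed.

Lemma sum_approx J (a : 'I_J -> int) (x : 'I_J -> R) (w k : R) :
  (forall j, `|(a j)%:~R - k * x j| <= w * k) ->
  `|(\sum_j a j)%:~R - k * \sum_j x j| <= w * k * J%:R.
Proof.
move=> ax; rewrite raddf_sum mulr_sumr -sumrB /=.
apply: le_trans (ler_norm_sum _ _ _) _.
rewrite -[J in leRHS]card_ord mulr_natr -sumr_const; exact: ler_sum.
Qed.

Lemma multiplicity_bound (r k w m s C a : R) (M : nat) : 1 < r -> 0 < k -> 0 < w -> 0 <= C ->
  w * (C + r) <= s - r^-1 * m -> w * (C + r) <= r * m - s -> 1 <= w * k ->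
  M%:R <= k * m -> k * m < M%:R + 1 -> `|a - k * s| <= w * k * C ->
  r^-1 * M%:R <= a <= r * M%:R.
Proof.
move=> r1 k0 w0 C0 h1 h2 wk Mk kM; rewrite ler_norml => /andP[? ?].
have r0 : 0 < r by lra.
have ri0 : 0 < r^-1 by rewrite invr_gt0.
have wk0 : 0 < w * k by rewrite mulr_gt0.
have h1' : k * (w * (C + r)) <= k * (s - r^-1 * m) by rewrite ler_pM2l.
have h2' : k * (w * (C + r)) <= k * (r * m - s) by rewrite ler_pM2l.
have a1 : r^-1 * M%:R <= r^-1 * (k * m) by rewrite ler_pM2l.
have a2 : r * (k * m - 1) <= r * M%:R by rewrite ler_pM2l//; lra.
have a3 : r * 1 <= r * (w * k) by rewrite ler_pM2l.
have a4 : 0 <= r * (w * k) by rewrite mulr_ge0 ?ltW.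
by apply/andP; split; lra.
Qed.

Lemma approx_ge (k w s x : R) : 0 < k -> w * 2 <= s -> `|x - k * s| <= w * k -> w * k <= x.
Proof.
move=> k0 ws; rewrite ler_norml => /andP[? _].
have : k * (w * 2) <= k * s by rewrite ler_pM2l.
lra.
Qed.

(** Refine the old generators together with [x], [u1], [u2]. The column of a generator is almost
    constant on each half, about [k] times its two states, so the entries inherit the ratios and
    sums of [L]. *)
Lemma next_level_exists (r r' : R) (a : nat) x L :
  good_level r L -> 1 < r < 2 -> 1 < r' < 2 -> 0 < S1 x -> 0 < S2 x ->
  exists L', good_level r' L' /\ exists A, @next_level r a x L L' A.
Proof.
move=> [[J0 K4 l4] [m [al1 al2 [m0 ms1 ms2]]] c1 c2 _] r12 r'12 x1 x2.
have /andP[r1 r2] := r12; pose J := width L; pose l : R := (lev_l L)%:R.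
have l0 : 0 < l by rewrite ltr0n (leq_trans _ l4).
have C0 : 0 <= r + l + 1 by lra.
have CJ0 : 0 <= J%:R + r by rewrite addr_ge0 ?ler0n//; lra.
have [w [[w0 w1] [w2 w3] [w4 w5] [[w6 w7] [w8 w9]] [w10 w11]]] : exists w : R,
  [/\ 0 < w /\ (forall j, w * 2 <= S1 (gens L j)),
      (forall j, w * 2 <= S2 (gens L j)) /\ (w * 2 <= S1 x /\ w * 2 <= S2 x),
      (forall j, w * (r + l + 1) <= r * S1 (gens1 L j) - l * S2 (gens1 L j)) /\
      (forall j, w * (r + l + 1) <= l * S2 (gens1 L j) - r^-1 * S1 (gens1 L j)),
      ((forall j, w * (r + l + 1) <= r * S2 (gens2 L j) - l * S1 (gens2 L j)) /\
      (forall j, w * (r + l + 1) <= l * S1 (gens2 L j) - r^-1 * S2 (gens2 L j))) /\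
      (w * (J%:R + r) <= \sum_j S1 (gens1 L j) - r^-1 * m /\
      w * (J%:R + r) <= r * m - \sum_j S1 (gens1 L j))
    & w * (J%:R + r) <= \sum_j S2 (gens2 L j) - r^-1 * m /\
      w * (J%:R + r) <= r * m - \sum_j S2 (gens2 L j)].
  move: ms1 ms2 => /andP[? ?] /andP[? ?].
  have gens_gt0 j : 0 < S1 (gens L j) /\ 0 < S2 (gens L j).
    by case: (split_ordP j) => i ->; [have [] := al1 i | have [] := al2 i].
  near ((0 : R)^'+) => w; exists w; split; split; try split.
  - by near: w; exact: nbhs_right_gt.
  - by near: w; apply: filter_forall => j; apply: near_slack => //; case: (gens_gt0 j).
  - by near: w; apply: filter_forall => j; apply: near_slack => //; case: (gens_gt0 j).
  - by near: w; exact: near_slack.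
  - by near: w; exact: near_slack.
  - near: w; apply: filter_forall => j; apply: near_slack => //.
    by have [_ _ /andP[_]] := al1 j; rewrite subr_gt0.
  - near: w; apply: filter_forall => j; apply: near_slack => //.
    by have [_ _ /andP[+ _]] := al1 j; rewrite subr_gt0.
  - near: w; apply: filter_forall => j; apply: near_slack => //.
    by have [_ _ /andP[_]] := al2 j; rewrite subr_gt0.
  - near: w; apply: filter_forall => j; apply: near_slack => //.
    by have [_ _ /andP[+ _]] := al2 j; rewrite subr_gt0.
  - by near: w; apply: near_slack => //; rewrite subr_gt0.
  - by near: w; apply: near_slack => //; rewrite subr_gt0.
  - by near: w; apply: near_slack => //; rewrite subr_gt0.
  - by near: w; apply: near_slack => //; rewrite subr_gt0.
pose f (i : 'I_((J + J) + 3)) := match fintype.split i with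
  | inl j => gens L j | inr j => if j == 0 then x else if j == 1 then u1 else u2 end.
have fl j : f (lshift 3 j) = gens L j by rewrite /f (unsplitK (inl _ _)).
have fr j : f (rshift (J + J) j) = if j == 0 then x else if j == 1 then u1 else u2.
  by rewrite /f (unsplitK (inr _ _)).
(* The three terms yield [a <= w * k], [1 <= w * k] and the growth of the multiplicity. *)
pose q := a%:R / w + w^-1 + ((lev_M L).+2)%:R / m.
have q0 : 0 <= q by rewrite /q !addr_ge0// ?invr_ge0 ?divr_ge0 ?ler0n ?(ltW w0) ?(ltW m0).
pose X := ((Num.truncn q).+1 + (lev_K L).+1 + (lev_l L).+1)%N.
have [J' [g [A [l' [K' [k [good [XK Xl Xk k0] [gA kerA] approx]]]]]]] :=
  @levels_of_family _ f (rshift (J + J) 1) (rshift (J + J) ord_max) r' w X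
    (fr 1) (fr ord_max) r'12 w0.
have qk : q < k.
  have /andP[_ lt] := truncn_itv q0; apply: lt_le_trans lt (le_trans _ Xk).
  by rewrite ler_nat /X -addnA leq_addr.
have [aw wV mM] : [/\ 0 <= a%:R / w, 0 <= w^-1 & 0 <= ((lev_M L).+2)%:R / m].
  by rewrite invr_ge0 !divr_ge0 ?ler0n ?(ltW w0) ?(ltW m0).
have awk : a%:R <= w * k.
  by rewrite mulrC -ler_pdivrMr//; move: qk; rewrite /q; lra.
have wk1 : 1 <= w * k.
  by rewrite mulrC -ler_pdivrMr// div1r; move: qk; rewrite /q; lra.
have Mkm : (lev_M L).+2%:R <= k * m.
  by rewrite -ler_pdivrMr//; move: qk; rewrite /q; lra.
have km0 : 0 <= k * m by rewrite mulr_ge0 ?(ltW k0) ?(ltW m0).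
have /andP[Mk kM] := truncn_itv km0.
move: kM; rewrite -natr1 => kM.
pose M' := Num.truncn (k * m).
pose L' := Level g (col (rshift (J + J) 1) A) (col (rshift (J + J) ord_max) A) K' l' M'.
exists L'; split; first exact: good.
have mulA v u : A *m col_mx v u = lsubmx A *m v + rsubmx A *m u.
  by rewrite -mul_row_col hsubmxK.
have fcomb v u : combine f (col_mx v u) = combine (gens L) v + combine (fun j => f (rshift _ j)) u.
  rewrite /combine big_split_ord /=; congr (_ + _); apply: eq_bigr => j _.
    by rewrite col_mxEu fl.
  by rewrite col_mxEd.
(* The family contains [u1] and [u2] besides the generators, so their old coordinates give
   relations, which the refinement kills. *)
have coordE (c : 'cV_(J + J)) j : combine (gens L) c = f (rshift _ j) ->
    lsubmx A *m c = col (rshift _ j) A.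
  move=> cE; have /kerA : combine f (col_mx c (- delta_mx j 0)) = 0.
    by rewrite fcomb raddfN /= combine_delta cE subrr.
  rewrite mulA mulmxN => /eqP; rewrite subr_eq0 => /eqP ->.
  by rewrite -colE; apply/matrixP => i i'; rewrite !mxE.
have large1 j i : w * 2 <= S1 (f i) -> w * k <= (A (lshift J' j) i)%:~R.
  by move=> wf; have [h _] := approx j i; apply: approx_ge wf h.
have large2 j i : w * 2 <= S2 (f i) -> w * k <= (A (rshift J' j) i)%:~R.
  by move=> wf; have [_ h] := approx j i; apply: approx_ge wf h.
have wk0 : 0 < w * k by rewrite mulr_gt0.
have pos (z : int) : w * k <= z%:~R -> 0 < z.
  by move=> wz; rewrite -(ltr0z R); apply: lt_le_trans wz.
have age (z : int) : w * k <= z%:~R -> a%:Z <= z.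
  by move=> wz; rewrite -(ler_int R); apply: le_trans wz.
exists (lsubmx A); split.
- split=> /=.
  + by apply: leq_trans XK; rewrite /X addnAC leq_addl.
  + by apply: leq_trans Xl; rewrite /X leq_addl.
  + have : (lev_M L).+2%:R < M'%:R + 1 :> R by apply: le_lt_trans kM.
    by rewrite natr1 ltr_nat ltnS => /ltnW.
- split=> v.
    by rewrite -[RHS]addr0 -(raddf0 (combine (fun j => f (rshift _ j)))) -fcomb -gA mulA mulmx0 addr0.
  move=> v0; have /kerA : combine f (col_mx v 0) = 0 by rewrite fcomb v0 raddf0 addr0.
  by rewrite mulA mulmx0 addr0.
- by split; apply: coordE; rewrite fr.
- exists (col (rshift _ 0) A); split; last first.
    by rewrite /= colE gA combine_delta fr.
  move=> i; rewrite mxE ltW//; apply: pos.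
  by case: (split_ordP i) => j ->; [apply: large1 | apply: large2]; rewrite fr; case: w3.
- split.
  + move=> j' j; rewrite !mxE; split.
    * by apply/pos/large1; rewrite fl; exact: w1.
    * by apply/pos/large2; rewrite fl; exact: w2.
    * by apply/age/large1; rewrite fl; exact: w1.
    * by apply/age/large2; rewrite fl; exact: w2.
  + move=> j' j'' j; rewrite !mxE.
    have [h1 _] := approx j' (lshift 3 (lshift J j)).
    have [_ h2] := approx j'' (lshift 3 (lshift J j)).
    by move: h1 h2; rewrite fl; exact: (ratio_perturbed r1 l0 k0 (w4 j) (w5 j) w0).
  + move=> j' j'' j; rewrite !mxE.
    have [_ h1] := approx j' (lshift 3 (rshift J j)).
    have [h2 _] := approx j'' (lshift 3 (rshift J j)).
    by move: h1 h2; rewrite fl; exact: (ratio_perturbed r1 l0 k0 (w6 j) (w7 j) w0).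
  + move=> j'; apply: (multiplicity_bound r1 k0 w0 (ler0n R J) w8 w9 wk1 Mk kM).
    apply: sum_approx => j; rewrite mxE.
    by have [+ _] := approx j' (lshift 3 (lshift J j)); rewrite fl.
  + move=> j'; apply: (multiplicity_bound r1 k0 w0 (ler0n R J) w10 w11 wk1 Mk kM).
    apply: sum_approx => j; rewrite mxE.
    by have [_] := approx j' (lshift 3 (rshift J j)); rewrite fl.
Unshelve. all: by end_near.
Qed.

End Levels.

Arguments gens {G}.

(** * The rational tolerances *)

Section Ratios.
Variable R : realType.

Definition ratio n : rat := 1 + n.+2%:R^-1.

Lemma ratr_ratio n : ratr (ratio n) = 1 + harmonic n.+1 :> R.
Proof. by rewrite /ratio rmorphD rmorph1 fmorphV rmorph_nat. Qed.

Lemma ratio_itv n : 1 < ratio n < 2.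
Proof.
rewrite /ratio ltrDl invr_gt0 ltr0n/=.
by rewrite -[ltRHS]/(1 + 1) ltrD2l invf_lt1 ?ltr0n// ltr1n.
Qed.

Lemma ratr_ratio_itv n : 1 < (ratr (ratio n) : R) < 2.
Proof.
have /andP[r1 r2] := ratio_itv n; apply/andP; split.
  by rewrite -(rmorph1 (@ratr R)) ltr_rat.
by rewrite -(rmorph_nat (@ratr R) 2) ltr_rat.
Qed.

Lemma ratio_decreasing : decreasing_seq ratio.
Proof. by apply/decreasing_seqP => n; rewrite /ratio ltrD2l ltf_pV2 ?posrE ?ltr0n// ltr_nat. Qed.

Lemma ratio_cvg : ratr (ratio n) @[n --> \oo] --> (1 : R).
Proof.
under eq_fun do rewrite ratr_ratio.
have : 1 + harmonic n.+1 @[n --> \oo] --> (1 + 0 : R).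
  apply: cvgD; first exact: cvg_cst.
  by have := @cvg_harmonic R; rewrite -cvg_shiftS.
by rewrite addr0.
Qed.

Lemma in_range_ratr (lo hi : rat) (x : int) :
  ratr lo <= (x%:~R : R) -> (x%:~R : R) <= ratr hi -> in_range lo hi x.
Proof. by rewrite -(ratr_int R) !ler_rat /in_range => -> ->. Qed.

Lemma in_range_scaled (r : rat) (lo hi : rat) (x : int) :
  (ratr r)^-1 * ratr lo <= (x%:~R : R) <= ratr r * ratr hi -> in_range (r^-1 * lo) (r * hi) x.
Proof. by move=> /andP[h1 h2]; apply: in_range_ratr; rewrite rmorphM ?fmorphV. Qed.

End Ratios.

Lemma extremal_pair_cone (R : realType) (G : zmodType) (P : set G) (e : G)
    (sigma1 sigma2 : G -> R) :
  dimension_group P -> order_unit P e -> extremal_states P e = [set sigma1; sigma2] ->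
  forall g, 0 < sigma1 g -> 0 < sigma2 g -> P g.
Proof.
move=> dimG unit_e extE g g1 g2; apply: contrapT => nPg.
have ext1 : extremal_states P e sigma1 by rewrite extE; left.
have [ordG _] := dimG.
have [tau []] := extremal_state_le0 ordG unit_e (@dim_unperforated _ _ dimG) ext1.1 nPg.
by rewrite extE => -[->|->]; rewrite leNgt ?g1 ?g2.
Qed.

(* Sequences are indexed from 0: index n here is index n + 1 of a sequence
   indexed by n = 1, 2, and so on. *)
Theorem theorem1p4 (R : realType) (G : zmodType) (P : set G)
    (e u1 u2 : G) (sigma1 sigma2 : G -> R) (a : nat -> nat)
    (dimG : dimension_group P)
    (simpleG : simple_group P)
    (unit_e : order_unit P e)
    (sigma1_neq_sigma2 : sigma1 <> sigma2)
    (extremalE : extremal_states P e = [set sigma1; sigma2])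
    (sigma1_u1 : sigma1 u1 = 1) (sigma2_u2 : sigma2 u2 = 1)
    (sigma2_u1 : sigma2 u1 = 0) (sigma1_u2 : sigma1 u2 = 0)
    (a_gt0 : forall n, (0 < a n)%N) :
  exists (J : nat -> nat)
    (u11 u12 u21 u22 : forall n, 'cV[int]_(J n))
    (A11 A12 A21 A22 : forall n, 'M[int]_(J n.+1, J n)),
    let A n := block_mx (A11 n) (A12 n) (A21 n) (A22 n) in
    [/\ forall n, (0 < J n)%N,
        forall n j' j, [/\ 0 < A11 n j' j, 0 < A12 n j' j,
                           0 < A21 n j' j & 0 < A22 n j' j],
        exists eta : forall n, {additive 'cV[int]_(J n + J n) -> G},
          [/\ inductive_limit A P eta,
              forall n, eta n (col_mx (u11 n) (u12 n)) = u1,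
              forall n, eta n (col_mx (u21 n) (u22 n)) = u2,
              forall n, A n *m col_mx (u11 n) (u12 n)
                        = col_mx (u11 n.+1) (u12 n.+1)
            & forall n, A n *m col_mx (u21 n) (u22 n)
                        = col_mx (u21 n.+1) (u22 n.+1)]
      & exists (r : nat -> rat) (K l M : nat -> nat),
        [/\ [/\ decreasing_seq r, forall n, 1 < r n < 2
              & ratr (r n) @[n --> \oo] --> (1 : R)],
            [/\ increasing_seq K, increasing_seq l, increasing_seq M
              & forall n, [/\ (4 <= K n)%N, (4 <= l n)%N & (4 <= M n)%N]],
            forall n (j : 'I_(J n)),
              [/\ in_range ((r n)^-1 * (K n)%:R) (r n * (K n)%:R) (u11 n j 0),
                  in_range ((r n)^-1 * (K n)%:R) (r n * (K n)%:R) (u22 n j 0),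
                  in_range (- (r n * (K n)%:R)) (- ((r n)^-1 * (K n)%:R))
                         ((l n)%:Z * u12 n j 0)
                & in_range (- (r n * (K n)%:R)) (- ((r n)^-1 * (K n)%:R))
                         ((l n)%:Z * u21 n j 0)],
            forall n (j' j'' : 'I_(J n.+1)) (j : 'I_(J n)),
              [/\ (a n)%:Z <= A12 n j' j,
                  (a n)%:Z <= A21 n j' j,
                  in_range ((r n)^-1 * (A11 n j' j)%:~R) (r n * (A11 n j' j)%:~R)
                         ((l n)%:Z * A21 n j'' j)
                & in_range ((r n)^-1 * (A22 n j' j)%:~R) (r n * (A22 n j' j)%:~R)
                         ((l n)%:Z * A12 n j'' j)]
          & forall n (j' : 'I_(J n.+1)),
              in_range ((r n)^-1 * (M n)%:R) (r n * (M n)%:R)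
                     (\sum_j A11 n j' j) /\
              in_range ((r n)^-1 * (M n)%:R) (r n * (M n)%:R)
                     (\sum_j A22 n j' j)]].
Proof.
have [ordG _] := dimG; have [/countable_injP[code code_inj] _ _ _] := ordG.
have ext1 : extremal_states P e sigma1 by rewrite extremalE; left.
have ext2 : extremal_states P e sigma2 by rewrite extremalE; right.
have posP := extremal_pair_cone dimG unit_e extremalE.
have dense t1 t2 eps (eps0 : 0 < eps) :=
  states_dense dimG simpleG unit_e t1 t2 ext1 ext2 sigma1_neq_sigma2 eps0.
have [D1 pos1 e1] := ext1.1; have [D2 pos2 e2] := ext2.1.
have gt1 x (Px : P x) (x0 : x <> 0) := state_gt0 ordG simpleG ext1.1 Px x0.
have gt2 x (Px : P x) (x0 : x <> 0) := state_gt0 ordG simpleG ext2.1 Px x0.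
have [S1 E1] := morph_additive D1; have [S2 E2] := morph_additive D2.
move: sigma1_u1 sigma2_u2 sigma2_u1 sigma1_u2 posP dense e1 e2 gt1 gt2.
rewrite -E1 -E2 => S11 S22 S21 S12 posP dense e1 e2 gt1 gt2.
(* The default [e] has both states equal to 1, so every term can be fed to a refinement. *)
pose x n := if pselect (exists y, [/\ P y, y <> 0 & code y = n]) is left ex
  then projT1 (cid ex) else e.
have x_gt0 n : 0 < S1 (x n) /\ 0 < S2 (x n).
  rewrite /x; case: pselect => [ex|_]; last by rewrite e1 e2.
  by case: cid => y /= [Py y0 _]; split; [apply: gt1 | apply: gt2].
have x_surj y : P y -> y <> 0 -> x (code y) = y.
  move=> Py y0; rewrite /x; case: pselect => [ex|[]]; last by exists y.
  by case: cid => z /= [_ _ ez]; apply: code_inj; rewrite ?inE.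
pose r n : R := ratr (ratio n).
(* The invariant sits under the existential, so that choice applies to arbitrary levels. *)
have step (nL : nat * level G) : exists L', good_level S1 S2 u1 u2 (r nL.1) nL.2 ->
    good_level S1 S2 u1 u2 (r nL.1.+1) L' /\
    exists A, @next_level R G (r nL.1) (a nL.1) (x nL.1) nL.2 L' A.
  have [good|?] := EM (good_level S1 S2 u1 u2 (r nL.1) nL.2); last by exists nL.2.
  have [x1 x2] := x_gt0 nL.1.
  have [L' [good' ex]] := next_level_exists dimG dense S11 S21 S12 S22 (a nL.1) good
    (ratr_ratio_itv R nL.1) (ratr_ratio_itv R nL.1.+1) x1 x2.
  by exists L'.
have [next nextE] := choice step.
have [L0 [good0 M0]] := initial_level dimG dense S11 S21 S12 S22 (ratr_ratio_itv R 0).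
pose L := fix L n := if n is n'.+1 then next (n', L n') else L0.
have good n : good_level S1 S2 u1 u2 (r n) (L n).
  by elim: n => [//|n IH]; have [] := nextE (n, L n) IH.
have exA n : exists A, @next_level R G (r n) (a n) (x n) (L n) (L n.+1) A.
  by have [_] := nextE (n, L n) (good n).
pose A n := projT1 (cid (exA n)).
have AE n : next_level (r n) (a n) (x n) (A n) := projT2 (cid (exA n)).
clearbody A.
exists (fun n => width (L n)).
exists (fun n => usubmx (coords1 (L n))), (fun n => dsubmx (coords1 (L n))).
exists (fun n => usubmx (coords2 (L n))), (fun n => dsubmx (coords2 (L n))).
exists (fun n => ulsubmx (A n)), (fun n => ursubmx (A n)).
exists (fun n => dlsubmx (A n)), (fun n => drsubmx (A n)) => B.
have BE : B = A by apply: functional_extensionality_dep => n; rewrite /B submxK.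
have int_gt0 n (z : int) : (a n)%:Z <= z -> 0 < z.
  by apply: lt_le_trans; rewrite ltz_nat.
split.
- by move=> n; have [[]] := good n.
- move=> n j' j; have [_ _ _ _ [+ _ _ _ _]] := AE n => /(_ j' j) [A11 _ A12 _].
  have [_ _ _ _ [+ _ _ _ _]] := AE n => /(_ j' j) [_ A22 _ A21].
  by rewrite !mxE; split=> //; [exact: int_gt0 A12 | exact: int_gt0 A21].
- have etaA n v : combine (gens (L n.+1)) (A n *m v) = combine (gens (L n)) v.
    by have [_ [+ _] _ _ _] := AE n; apply.
  have gensP n j : P (gens (L n) j).
    have [_ [m [al1 al2 _]] _ _ _] := good n.
    by case: (split_ordP j) => i ->; [have [] := al1 i | have [] := al2 i] => *; apply: posP.
  exists (fun n => combine (gens (L n))); rewrite BE; split.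
  + apply: limit_criterion => //.
    * split=> // n v v0; rewrite /= /combine.
      apply: (big_ind P); [exact: cone0|exact: coneD|move=> i _].
      have := v0 i; case: (v i 0) => // m _; rewrite -pmulrn; exact: coneMn.
    * move=> y Py; have [->|/eqP y0] := eqVneq y 0.
        by exists 0%N, 0; split=> [i|]; rewrite ?mxE// raddf0.
      have [_ _ _ [v [v0 vE]] _] := AE (code y).
      by exists (code y).+1, v; split=> //; rewrite /= vE x_surj.
    * by move=> n v v0; exists 1%N => /=; have [_ [_ +] _ _ _] := AE n; apply.
  + by move=> n; rewrite vsubmxK; have [] := good n.
  + by move=> n; rewrite vsubmxK; have [] := good n.
  + by move=> n; rewrite !vsubmxK; have [_ _ [+ _] _ _] := AE n.
  + by move=> n; rewrite !vsubmxK; have [_ _ [_ +] _ _] := AE n.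
(* The multiplicity of the [n]-th matrix is stored at its target, hence the shift. *)
exists ratio, (fun n => lev_K (L n)), (fun n => lev_l (L n)), (fun n => lev_M (L n.+1)).
have M_lt n : (lev_M (L n) < lev_M (L n.+1))%N by have [[]] := AE n.
have M_ge3 n : (3 <= lev_M (L n))%N.
  by elim: n => [|n IH]; [rewrite /= M0 | apply: leq_trans IH (ltnW (M_lt n))].
have opp_range n (K z : nat) (y : int) :
    (r n)^-1 * K%:R < - (z%:R * y%:~R) < r n * K%:R ->
    in_range (- (ratio n * K%:R)) (- ((ratio n)^-1 * K%:R)) (z%:Z * y).
  move=> /andP[h1 h2]; apply: (@in_range_ratr R); rewrite rmorphN !rmorphM ?fmorphV rmorph_nat.
    by rewrite lerNl ltW.
  by rewrite lerNr ltW.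
have range n (K : nat) (y : int) : (r n)^-1 * K%:R < y%:~R < r n * K%:R ->
    in_range ((ratio n)^-1 * K%:R) (ratio n * K%:R) y.
  move=> /andP[h1 h2]; apply: (@in_range_scaled R).
  by rewrite !rmorph_nat !ltW.
split.
- by split; [exact: ratio_decreasing | exact: ratio_itv | exact: ratio_cvg].
- split; try by apply/increasing_seqP => n; have [[]] := AE n.
    by apply/increasing_seqP => n; exact: M_lt.
  move=> n; have [[_ ? ?] _ _ _ _] := good n; split=> //.
  exact: leq_ltn_trans (M_ge3 n) (M_lt n).
- move=> n j; have [_ _ _ _ /(_ j)[h1 h2 h3 h4]] := good n.
  by rewrite !mxE; split; [exact: range|exact: range|exact: opp_range|exact: opp_range].
- move=> n j' j'' j; have [_ _ _ _ [ge h1 h2 _ _]] := AE n; rewrite !mxE.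
  have [_ _ ? ?] := ge j' j.
  split=> //; apply: (@in_range_scaled R); rewrite !rmorph_int intrM;
    [exact: h1 | exact: h2].
- move=> n j'; have [_ _ _ _ [_ _ _ h1 h2]] := AE n.
  split; apply: (@in_range_scaled R); rewrite !rmorph_nat.
    by under eq_bigr do rewrite !mxE; exact: h1.
  by under eq_bigr do rewrite !mxE; exact: h2.
Qed.
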